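(* Let $(\Omega,\mathcal{C},\Lambda)$ be a naive convex co-compact triple in $\mathbb{P}(\mathbb{R}^d)$. If $A\le\Lambda$ is a maximal Abelian subgroup of $\Lambda$, then there exists a properly embedded simplex $S\subset\mathcal{C}$ such that (1) $S$ is $A$-invariant (i.e. $aS=S$ for all $a\in A$), (2) $A$ acts co-compactly on $S$, and (3) $A$ fixes each vertex of $S$. Moreover, $A$ has a finite index subgroup isomorphic to $\mathbb{Z}^{\dim(S)}$.
   Context: A subset $C\subset\mathbb{P}(\mathbb{R}^d)$ is properly convex if there is an affine chart of $\mathbb{P}(\mathbb{R}^d)$ in which $C$ is a bounded convex set; a properly convex domain is a properly convex set that is open in $\mathbb{P}(\mathbb{R}^d)$. For a properly convex domain $\Omega$, $\mathrm{Aut}(\Omega)=\{g\in\mathrm{PGL}_d(\mathbb{R}): g\Omega=\Omega\}$. A naive convex co-compact triple $(\Omega,\mathcal{C},\Lambda)$ consists of a properly convex domain $\Omega\subset\mathbb{P}(\mathbb{R}^d)$, an infinite discrete subgroup $\Lambda\le\mathrm{Aut}(\Omega)$, and a non-empty closed (in $\Omega$) convex subset $\mathcal{C}\subset\Omega$ with $g\mathcal{C}=\mathcal{C}$ for all $g\in\Lambda$ and $\Lambda\backslash\mathcal{C}$ compact. A subset $S\subset\mathbb{P}(\mathbb{R}^d)$ is a simplex if there exist $g\in\mathrm{PGL}_d(\mathbb{R})$ and $1\le k\le d$ with $gS=\{[x_1:\dots:x_k:0:\dots:0]: x_1>0,\dots,x_k>0\}$; then $\dim S=k-1$ and its vertices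 are the $k$ points $g^{-1}[e_1],\dots,g^{-1}[e_k]$ ($e_i$ the standard basis). For $A\subset B\subset\mathbb{P}(\mathbb{R}^d)$, $A$ is properly embedded in $B$ if the inclusion $A\hookrightarrow B$ is a proper map (subspace topologies). A group $G$ acts co-compactly on a set $X$ if there is a compact $K\subset X$ with $G\cdot K=X$. *)

(* Defs.v *)
From Stdlib Require Import Reals Lra List ZArith.
Open Scope R_scope.

(* Vectors of R^d and d x d matrices are represented by functions on nat;
   only the indices < d are ever inspected. *)
Definition vec := nat -> R.
Definition mat := nat -> nat -> R.

Fixpoint rsum (n : nat) (f : nat -> R) : R :=
  match n with O => 0 | S m => rsum m f + f m end.

Definition mat_act (d : nat) (g : mat) (v : vec) : vec :=
  fun i => rsum d (fun j => g i j * v j).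
Definition mat_mul (d : nat) (g h : mat) : mat :=
  fun i j => rsum d (fun k => g i k * h k j).
Definition mat_id : mat := fun i j => if Nat.eqb i j then 1 else 0.
Definition basis (i : nat) : vec := fun j => if Nat.eqb i j then 1 else 0.

Definition nz_vec (d : nat) (v : vec) : Prop := exists i, (i < d)%nat /\ v i <> 0.

Definition pt_eq (d : nat) (v w : vec) : Prop :=
  nz_vec d v /\ nz_vec d w /\
  exists c, c <> 0 /\ forall i, (i < d)%nat -> v i = c * w i.

Definition mat_peq (d : nat) (g h : mat) : Prop :=
  exists c, c <> 0 /\ forall i j, (i < d)%nat -> (j < d)%nat -> g i j = c * h i j.

Definition invertible (d : nat) (g : mat) : Prop :=
  exists h, forall i j, (i < d)%nat -> (j < d)%nat -> mat_mul d g h i j = mat_id i j.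

(* A subset of P(R^d) is a predicate on nonzero vectors invariant under
   projective equivalence. *)
Definition pset (d : nat) (S : vec -> Prop) : Prop :=
  (forall v, S v -> nz_vec d v) /\ (forall v w, pt_eq d v w -> S v -> S w).

(* Metric on P(R^d) inducing its usual topology. *)
Definition vnorm (d : nat) (v : vec) : R := sqrt (rsum d (fun i => v i * v i)).
Definition pdist (d : nat) (v w : vec) : R :=
  Rmin (vnorm d (fun i => v i / vnorm d v - w i / vnorm d w))
       (vnorm d (fun i => v i / vnorm d v + w i / vnorm d w)).

(* Metric on PGL_d(R) (as an open subset of P(M_d(R))). *)
Definition mnorm (d : nat) (g : mat) : R :=
  sqrt (rsum d (fun i => rsum d (fun j => g i j * g i j))).
Definition mdist (d : nat) (g h : mat) : R :=
  Rmin (mnorm d (fun i j => g i j / mnorm d g - h i j / mnorm d h))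
       (mnorm d (fun i j => g i j / mnorm d g + h i j / mnorm d h)).

Definition open_P (d : nat) (U : vec -> Prop) : Prop :=
  forall v, U v -> exists eps, eps > 0 /\
    forall w, nz_vec d w -> pdist d v w < eps -> U w.

Definition compact_P (d : nat) (K : vec -> Prop) : Prop :=
  forall (I : Type) (U : I -> vec -> Prop),
    (forall i, open_P d (U i)) ->
    (forall v, K v -> exists i, U i v) ->
    exists l : list I, forall v, K v -> exists i, In i l /\ U i v.

Definition closed_in (d : nat) (Om C : vec -> Prop) : Prop :=
  forall v, Om v -> (forall eps, eps > 0 -> exists w, C w /\ pdist d v w < eps) -> C v.

Definition rel_open (d : nat) (C U : vec -> Prop) : Prop :=
  forall v, C v -> U v -> exists eps, eps > 0 /\
    forall w, C w -> pdist d v w < eps -> U w.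

Definition fval (d : nat) (f v : vec) : R := rsum d (fun i => f i * v i).

(* convexity of C in the affine chart {f <> 0}, with affine coordinates v / f(v) *)
Definition chart_convex (d : nat) (f : vec) (C : vec -> Prop) : Prop :=
  (forall v, C v -> fval d f v <> 0) /\
  (forall v w t, C v -> C w -> 0 <= t <= 1 ->
     C (fun i => (1 - t) * (v i / fval d f v) + t * (w i / fval d f w))).

Definition convex_P (d : nat) (C : vec -> Prop) : Prop :=
  exists f, nz_vec d f /\ chart_convex d f C.

Definition properly_convex (d : nat) (C : vec -> Prop) : Prop :=
  exists f, nz_vec d f /\ chart_convex d f C /\
    exists M, forall v, C v -> vnorm d (fun i => v i / fval d f v) <= M.

Definition properly_convex_domain (d : nat) (Om : vec -> Prop) : Prop :=
  pset d Om /\ properly_convex d Om /\ open_P d Om.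

Definition in_Aut (d : nat) (Om : vec -> Prop) (g : mat) : Prop :=
  invertible d g /\ forall v, nz_vec d v -> (Om (mat_act d g v) <-> Om v).

(* subgroups of PGL_d(R), as sets of matrix representatives closed under
   projective equivalence *)
Definition subgroup (d : nat) (G : mat -> Prop) : Prop :=
  (forall g, G g -> invertible d g) /\
  (forall g h, G g -> mat_peq d g h -> G h) /\
  G mat_id /\
  (forall g h, G g -> G h -> G (mat_mul d g h)) /\
  (forall g, G g -> exists h, G h /\ mat_peq d (mat_mul d g h) mat_id).

Definition infinite_group (d : nat) (G : mat -> Prop) : Prop :=
  forall l : list mat, exists g, G g /\ forall h, In h l -> ~ mat_peq d g h.

Definition discrete_group (d : nat) (G : mat -> Prop) : Prop :=
  forall g, G g -> exists eps, eps > 0 /\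
    forall h, G h -> mdist d g h < eps -> mat_peq d g h.

(* Lambda \ C is compact (quotient topology): every cover of C by
   Lambda-invariant relatively open subsets has a finite subcover. *)
Definition quotient_compact (d : nat) (L : mat -> Prop) (C : vec -> Prop) : Prop :=
  forall (I : Type) (U : I -> vec -> Prop),
    (forall i, rel_open d C (U i)) ->
    (forall i g v, L g -> C v -> U i v -> U i (mat_act d g v)) ->
    (forall v, C v -> exists i, U i v) ->
    exists l : list I, forall v, C v -> exists i, In i l /\ U i v.

Definition naive_cc_triple (d : nat) (Om C : vec -> Prop) (L : mat -> Prop) : Prop :=
  properly_convex_domain d Om /\
  subgroup d L /\ infinite_group d L /\ discrete_group d L /\
  (forall g, L g -> in_Aut d Om g) /\
  pset d C /\ (exists v, C v) /\ (forall v, C v -> Om v) /\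
  closed_in d Om C /\ convex_P d C /\
  (forall g v, L g -> nz_vec d v -> (C (mat_act d g v) <-> C v)) /\
  quotient_compact d L C.

Definition abelian (d : nat) (A : mat -> Prop) : Prop :=
  forall a b, A a -> A b -> mat_peq d (mat_mul d a b) (mat_mul d b a).

Definition maximal_abelian_subgroup (d : nat) (L A : mat -> Prop) : Prop :=
  subgroup d A /\ (forall a, A a -> L a) /\ abelian d A /\
  (forall B, subgroup d B -> (forall a, A a -> B a) -> (forall b, B b -> L b) ->
     abelian d B -> forall b, B b -> A b).

Definition std_simplex (d k : nat) (w : vec) : Prop :=
  exists x, (forall i, (i < k)%nat -> x i > 0) /\
            (forall i, (k <= i)%nat -> x i = 0) /\ pt_eq d w x.

(* S is a simplex with g S = standard simplex of dimension k-1 *)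
Definition simplex_by (d : nat) (S : vec -> Prop) (g : mat) (k : nat) : Prop :=
  invertible d g /\ (1 <= k <= d)%nat /\
  (forall v, S v -> nz_vec d v) /\
  (forall v, nz_vec d v -> (S v <-> std_simplex d k (mat_act d g v))).

Definition simplex_vertex (d : nat) (g : mat) (k : nat) (v : vec) : Prop :=
  exists i, (i < k)%nat /\ pt_eq d (mat_act d g v) (basis i).

Definition properly_embedded (d : nat) (S C : vec -> Prop) : Prop :=
  forall K, compact_P d K -> (forall v, K v -> C v) ->
    compact_P d (fun v => K v /\ S v).

Definition acts_cocompactly (d : nat) (A : mat -> Prop) (S : vec -> Prop) : Prop :=
  exists K, compact_P d K /\ (forall v, K v -> S v) /\
    forall v, S v <-> exists a w, A a /\ K w /\ pt_eq d v (mat_act d a w).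

Definition zvec (m : nat) (u : nat -> Z) : Prop := forall i, (m <= i)%nat -> u i = 0%Z.

Definition iso_Zm (d m : nat) (B : mat -> Prop) : Prop :=
  exists phi : (nat -> Z) -> mat,
    (forall u, zvec m u -> B (phi u)) /\
    (forall u v, zvec m u -> zvec m v ->
       mat_peq d (phi (fun i => (u i + v i)%Z)) (mat_mul d (phi u) (phi v))) /\
    (forall u v, zvec m u -> zvec m v -> mat_peq d (phi u) (phi v) ->
       forall i, u i = v i) /\
    (forall b, B b -> exists u, zvec m u /\ mat_peq d (phi u) b).

Definition finite_index (d : nat) (B A : mat -> Prop) : Prop :=
  subgroup d B /\ (forall b, B b -> A b) /\
  exists l : list mat, (forall h, In h l -> A h) /\
    forall a, A a -> exists h b, In h l /\ B b /\ mat_peq d a (mat_mul d h b).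

(* Main.v *)
(** Lift everything to [R^d]: [Om] becomes an open convex cone on which a linear form [f] dominates
   the norm, and the elements of [A] lift to commuting matrices preserving it. Write [x <= y] when
   [y - x] lies in the closed cone.

   Choose finitely many [a] spanning the linear span of [A], and let [D] be the cone of those [x] in
   the lift of [C] with [a x <= s x] and [x <= s (a x)] for these [a]. It is convex and
   [A]-invariant. If [g] in [L] brings [x] in [D] back to a compact set, the conjugates of the
   chosen [a] by [g] range over a finite set, so [g] is determined up to finitely many choices
   modulo the centralizer of [A], which is [A] by maximality. Hence [A] acts co-compactly on [D], and by
   Zorn's lemma [D] contains a minimal [A]-invariant convex cone, again called [D], that is closed
   in [Om].

   A relatively interior point [x] of [D] satisfies [a x <= t x] for some [t], now for the order of
   [D] itself; the points that do so form an invariant cone, so by minimality all of [D] does. Hence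
   a point spanning an extreme ray is an eigenvector of all of [A], every point of [D] is a sum of
   common eigenvectors, and minimality forces [D] to be the open simplex spanned by linearly
   independent ones. The logarithms of the ratios of the eigenvalues map [A] onto a discrete
   co-compact subgroup of [R^(k-1)] with finite kernel; any [k - 1] independent elements generate a
   subgroup of finite index. *)

From mathcomp Require Import all_boot all_order all_algebra.
From mathcomp Require Import boolp classical_sets reals topology normedtype.
From mathcomp Require Import Rstruct ssrZ sequences exp ring lra.
Require Import Defs.
Set Implicit Arguments.
Unset Strict Implicit.
Unset Printing Implicit Defensive.
Import Order.TTheory GRing.Theory Num.Theory.
Import numFieldNormedType.Exports.
Local Open Scope ring_scope.

(** The cone order stands in for the Hilbert metric: [x <= c y] together with [y <= c x] bounds the
    Hilbert distance between two rays and also fixes their scale, so every compactness statement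
    becomes a pair of linear inequalities. [A] is not known to be finitely generated, which is why
    displacement is bounded on a basis of its linear span: commuting with that basis is the same as
    commuting with [A]. Conjugates are only controlled up to scalars, but matrices preserving the
    same proper cone that commute up to a scalar commute, by determinants and positivity.

    The cones are closed only in [Om], and the common eigenvectors may lie on the boundary of [Om];
    the order arguments on a minimal cone are therefore carried out in its closure, and points
    return to [Om] by adding an interior point. Co-compactness on the first cone is what makes
    Zorn's lemma applicable: every invariant subcone meets one fixed compact order interval, so a
    chain cannot shrink to nothing. Minimality is then used twice, to spread an inequality from one
    point to all, and to rule out points on proper faces. *)

Lemma mem_In (T : eqType) (x : T) (s : seq T) : x \in s -> List.In x s.
Proof.
by elim: s => //= y s IHs; rewrite inE => /orP[/eqP ->|/IHs]; [left|right].
Qed.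

(** * A norm on matrices *)

Section Norm.
Variable R : realType.

Definition nrm p q (X : 'M[R]_(p, q)) : R := \sum_i \sum_j `|X i j|.

Lemma nrm_ge0 p q (X : 'M[R]_(p, q)) : 0 <= nrm X.
Proof. by apply: sumr_ge0 => i _; apply: sumr_ge0 => j _. Qed.

Lemma nrm0 p q : nrm (0 : 'M[R]_(p, q)) = 0.
Proof. by rewrite /nrm big1 // => i _; rewrite big1 // => j _; rewrite mxE normr0. Qed.

Lemma nrmN p q (X : 'M[R]_(p, q)) : nrm (- X) = nrm X.
Proof. by apply: eq_bigr => i _; apply: eq_bigr => j _; rewrite mxE normrN. Qed.

Lemma nrmBC p q (X Y : 'M[R]_(p, q)) : nrm (X - Y) = nrm (Y - X).
Proof. by rewrite -nrmN opprB. Qed.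

Lemma nrmD p q (X Y : 'M[R]_(p, q)) : nrm (X + Y) <= nrm X + nrm Y.
Proof.
rewrite /nrm -big_split /=; apply: ler_sum => i _.
rewrite -big_split /=; apply: ler_sum => j _; rewrite mxE; exact: ler_normD.
Qed.

Lemma nrmZ p q c (X : 'M[R]_(p, q)) : nrm (c *: X) = `|c| * nrm X.
Proof.
rewrite /nrm mulr_sumr; apply: eq_bigr => i _.
by rewrite mulr_sumr; apply: eq_bigr => j _; rewrite mxE normrM.
Qed.

Lemma entry_le_nrm p q (X : 'M[R]_(p, q)) i j : `|X i j| <= nrm X.
Proof.
rewrite /nrm (bigD1 i) //= (bigD1 j) //= -addrA lerDl addr_ge0 //.
  by apply: sumr_ge0.
by apply: sumr_ge0 => *; apply: sumr_ge0.
Qed.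

Lemma nrm_le_entry p q (X : 'M[R]_(p, q)) e :
  (forall i j, `|X i j| <= e) -> nrm X <= (p * q)%:R * e.
Proof.
move=> H; apply: (@le_trans _ _ (\sum_(i < p) \sum_(j < q) e)).
  by apply: ler_sum => i _; apply: ler_sum => j _; apply: H.
by rewrite !sumr_const !card_ord -mulrnA mulnC -[e *+ _]mulr_natl.
Qed.

Lemma nrmM p q r (X : 'M[R]_(p, q)) (Y : 'M[R]_(q, r)) :
  nrm (X *m Y) <= nrm X * nrm Y.
Proof.
apply: (@le_trans _ _ (\sum_i \sum_j \sum_k `|X i k| * `|Y k j|)).
  apply: ler_sum => i _; apply: ler_sum => j _; rewrite mxE.
  apply: le_trans (ler_norm_sum _ _ _) _.
  by apply: ler_sum => k _; rewrite normrM.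
rewrite {1}/nrm mulr_suml; apply: ler_sum => i _.
rewrite exchange_big mulr_suml; apply: ler_sum => k _ /=.
rewrite -mulr_sumr ler_wpM2l // /nrm.
by rewrite [leRHS](bigD1 k) //= lerDl; apply: sumr_ge0 => *; apply: sumr_ge0.
Qed.

Definition opn p q (U : 'M[R]_(p, q) -> Prop) := 
  forall x : 'M[R]_(p, q), U x -> exists2 e : R, 0 < e & forall y, nrm (y - x) < e -> U y.

Definition cls p q (D : 'M[R]_(p, q) -> Prop) (x : 'M[R]_(p, q)) : Prop :=
  forall e : R, 0 < e -> exists2 y, D y & nrm (y - x) < e.

(** Boundedness and closedness are transported to row vectors with the sup norm; the factor [n.+1]
    compares it with the sum norm [nrm] and also covers [n = 0]. *)
Lemma heine_borel n (K : 'cV[R]_n -> Prop) (M : R) (I : Type)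
    (U : I -> 'cV[R]_n -> Prop) :
  (forall x, K x -> nrm x <= M) -> (forall x, cls K x -> K x) ->
  (forall i, opn (U i)) -> (forall x, K x -> exists i, U i x) ->
  exists l : list I, forall x, K x -> exists2 i, List.In i l & U i x.
Proof.
(* The cover form of compactness wants an index type with a choice structure, which classical choice
   supplies. *)
move=> KM Kcl; elim/Pchoice: I U => I U Uop Kcov.
pose K' : set 'rV[R]_n := fun x => K x^T.
have nrmlt (x y : 'rV[R]_n) e : ball x e y -> nrm (y^T - x^T) < n.+1%:R * e.
  move=> [e0 xy]; apply: (@le_lt_trans _ _ (n%:R * e)).
    have := @nrm_le_entry n 1 (y^T - x^T) e; rewrite muln1; apply=> i j; rewrite ord1 !mxE.
    by move: (xy ord0 i); rewrite /ball /= distrC => /ltW.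
  by rewrite ltr_pM2r // ltr_nat.
have scale (e : R) : 0 < e -> 0 < e / n.+1%:R by move=> e0; rewrite divr_gt0.
have scaleK (e : R) : n.+1%:R * (e / n.+1%:R) = e.
  by rewrite mulrC divfK // pnatr_eq0.
have cK : compact K'.
  apply: bounded_closed_compact.
    exists M; split; first exact: num_real.
    move=> r Mr x /KM xM; have r0 : 0 <= r.
      by apply: le_trans (ltW Mr); apply: le_trans xM; exact: nrm_ge0.
    rewrite /= [leLHS]/Num.norm /= mx_normrE; apply/bigmax_leP; split=> //= -[i j] _ /=.
    rewrite ord1; have := entry_le_nrm x^T j ord0; rewrite mxE => xj.
    by rewrite (le_trans xj)// (le_trans xM)// ltW.
  move=> x xcl; apply: Kcl => e e0.
  have [y [Ky xy]] := xcl _ (nbhsx_ballx x _ (scale _ e0)).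
  by exists y^T => //; have := nrmlt _ _ _ xy; rewrite scaleK.
rewrite compact_cover in cK.
pose U' (i : I) : set 'rV[R]_n := fun x => U i x^T.
have [i _|x /Kcov[i Ui]|D _ KD] := cK I setT U'.
- rewrite openE => x /Uop[e e0 eU]; apply/nbhs_ballP; exists (e / n.+1%:R) => /=.
    exact: scale.
  move=> y xy; apply: eU; have := nrmlt _ _ _ xy.
  by rewrite scaleK.
- by exists i.
exists (finmap.enum_fset D) => x Kx.
have [|i /= Di Ui] := KD x^T; first by rewrite /K' /= trmxK.
by exists i; [apply/mem_In|rewrite -(trmxK x)].
Qed.
End Norm.

(** * Spanning sets, pigeonhole and convex cones *)

Ltac mx_ring := apply/matrixP => ? ?; rewrite !mxE; ring.

(** A free sequence in [P] of maximal length, which exists because the dimension bounds the length.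
    [P] is an arbitrary predicate, so this serves groups and cones alike. *)
Lemma exists_spanning_subset (K : fieldType) (vT : vectType K) (P : vT -> Prop) :
  exists l : seq vT, [/\ forall x, x \in l -> P x, free l &
    forall x, P x -> x \in <<l>>%VS].
Proof.
pose Q m := `[< exists l : seq vT, [/\ forall x, x \in l -> P x, free l & size l = m] >].
have exQ : exists m, Q m by exists 0%N; apply/asboolP; exists [::]; rewrite nil_free.
have ubQ m : Q m -> (m <= \dim {:vT})%N.
  by move=> /asboolP[l [_ /eqP fl <-]]; rewrite -fl dimvS // subvf.
case: (ex_maxnP exQ ubQ) => m /asboolP[l [lP fl sl]] mmax.
exists l; split=> // x Px; apply: contrapT => /negP xl.
have /mmax : Q m.+1.
  apply/asboolP; exists (x :: l); rewrite free_cons fl xl /= sl; split=> //.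
  by move=> y; rewrite inE => /orP[/eqP ->|/lP].
by rewrite ltnn.
Qed.

(** Pigeonhole: one representative is kept for each key that is attained on [P]. *)
Lemma fiber_representatives (T : finType) (X : eqType) (key : X -> T) (P : X -> Prop) :
  exists2 l : seq X, forall x, x \in l -> P x &
    forall x, P x -> exists2 y, y \in l & key y = key x.
Proof.
suff [l lP ll] : exists2 l : seq X, forall x, x \in l -> P x &
    forall x, P x -> key x \in enum T -> exists2 y, y \in l & key y = key x.
  by exists l => // x Px; apply: ll => //; rewrite mem_enum.
elim: (enum T) => [|t s [l lP ll]]; first by exists [::].
have [[y [Py ty]]|N] := pselect (exists y, P y /\ key y = t); last first.
  exists l => // x Px; rewrite inE => /orP[/eqP xt|/ll]; last exact.
  by case: N; exists x.
exists (y :: l) => [x|x Px]; first by rewrite inE => /orP[/eqP ->|/lP].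
rewrite inE => /orP[/eqP xt|/(ll _ Px)[z zl zx]].
  by exists y; rewrite ?mem_head // ty xt.
by exists z => //; rewrite inE zl orbT.
Qed.

Section Cones.
Variable R : realType.

(** Total boundedness: the key records, for each entry, its cell in a grid of mesh [s]. *)
Lemma bounded_matrices_finite_key p q (B d : R) : 0 < d ->
  exists (T : finType) (key : 'M[R]_(p, q) -> T),
    forall X Y, nrm X <= B -> nrm Y <= B -> key X = key Y -> nrm (X - Y) < d.
Proof.
(* The successor makes the sum of [p * q] errors of size [s] strictly smaller than [d], also for
   empty matrices. *)
move=> d0; pose N := (p * q).+1; pose s := d / N%:R.
have s0 : 0 < s by rewrite divr_gt0.
pose K := Num.truncn ((B + B) / s).
pose c (X : 'M[R]_(p, q)) i j := Num.truncn ((X i j + B) / s).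
exists {ffun 'I_p * 'I_q -> 'I_K.+1}.
exists (fun X => [ffun ij => inord (c X ij.1 ij.2)]) => X Y XB YB /ffunP XY.
have bd (Z : 'M[R]_(p, q)) i j : nrm Z <= B ->
    ((c Z i j)%:R * s <= Z i j + B < (c Z i j).+1%:R * s) /\ (c Z i j < K.+1)%N.
  move=> ZB; have := le_trans (entry_le_nrm Z i j) ZB; rewrite ler_norml => /andP[Z1 Z2].
  have := @truncn_itv R ((Z i j + B) / s); rewrite divr_ge0 ?(ltW s0) //; last by lra.
  move=> /(_ isT) /andP[t1 t2]; split.
    by rewrite -ler_pdivlMr // -ltr_pdivrMr // t1 t2.
  by rewrite ltnS; apply: le_truncn; rewrite ler_pM2r ?invr_gt0 // lerD2r.
apply: (@le_lt_trans _ _ ((p * q)%:R * s)); last first.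
  by rewrite /s mulrA ltr_pdivrMr ?ltr0Sn // mulrC ltr_pM2l // ltr_nat.
apply: nrm_le_entry => i j.
have [/andP[x1 x2] xK] := bd X i j XB; have [/andP[y1 y2] yK] := bd Y i j YB.
have := XY (i, j); rewrite !ffunE /= => /(congr1 val); rewrite /= !inordK // => E.
rewrite E -addn1 natrD mulrDl mul1r in x1 x2; rewrite -addn1 natrD mulrDl mul1r in y2.
by rewrite !mxE ler_norml; apply/andP; split; lra.
Qed.

Section Generic.
Variable n : nat.
Implicit Types (D E U : 'cV[R]_n -> Prop) (x y z : 'cV[R]_n).

(** Only positive scalars are allowed, so that open cones, which miss the origin, qualify. *)
Definition cone D : Prop :=
  (forall x y, D x -> D y -> D (x + y)) /\
  (forall (c : R) x, 0 < c -> D x -> D (c *: x)).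

Lemma sub_cls D x : D x -> cls D x.
Proof. by move=> Dx e e0; exists x => //; rewrite subrr nrm0. Qed.

Lemma clsK D x : cls (cls D) x -> cls D x.
Proof.
move=> Dx e e0; have e2 : 0 < e / 2 by lra.
have [y Dy yx] := Dx _ e2; have [z Dz zy] := Dy _ e2; exists z => //.
rewrite (_ : z - x = (z - y) + (y - x)); last by rewrite addrA subrK.
by apply: le_lt_trans (nrmD _ _) _; lra.
Qed.

Lemma cls_lin (D : 'cV[R]_n -> Prop) m (E : 'cV[R]_m -> Prop) (g : 'M[R]_(m, n)) x :
  (forall y, D y -> E (g *m y)) -> cls D x -> cls E (g *m x).
Proof.
move=> gDE Dx e e0; have g0 : 0 < nrm g + 1 by have := nrm_ge0 g; lra.
have [y Dy yx] := Dx _ (divr_gt0 e0 g0).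
exists (g *m y); first exact: gDE.
rewrite -mulmxBr; apply: le_lt_trans (nrmM _ _) _.
rewrite ltr_pdivlMr // mulrC in yx; apply: le_lt_trans yx.
by rewrite ler_wpM2r ?nrm_ge0 // lerDl.
Qed.

Lemma clsS D E x : (forall y, D y -> E y) -> cls D x -> cls E x.
Proof. by move=> DE Dx e e0; have [y Dy] := Dx e e0; exists y; auto. Qed.

Lemma cls_scale D c x : cone D -> 0 < c -> cls D x -> cls D (c *: x).
Proof.
move=> [_ DZ] c0 Dx; rewrite -mul_scalar_mx; apply: cls_lin Dx => y Dy.
by rewrite mul_scalar_mx; apply: DZ.
Qed.

Lemma cls_add D x y : cone D -> cls D x -> cls D y -> cls D (x + y).
Proof.
move=> [DD _] Dx Dy e e0; have e2 : 0 < e / 2 by lra.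
have [x' Dx' xx] := Dx _ e2; have [y' Dy' yy] := Dy _ e2.
exists (x' + y'); first exact: DD.
rewrite opprD addrACA; apply: le_lt_trans (nrmD _ _) _; lra.
Qed.

Lemma cone_cls D : cone D -> cone (cls D).
Proof. by move=> cD; split=> *; [exact: cls_add|exact: cls_scale]. Qed.

(** The error made in approximating [x] by a point of [U] is absorbed by [y], around which [U] has
    room. *)
Lemma cls_opn_add U x y : cone U -> opn U -> cls U x -> U y -> U (x + y).
Proof.
move=> [UD _] oU Ux /oU[e e0 eU]; have [x' Ux' xx] := Ux _ e0.
rewrite (_ : x + y = x' + (y + (x - x'))); last by mx_ring.
by apply: UD => //; apply: eU; rewrite (_ : _ - y = x - x') 1?nrmBC //; mx_ring.
Qed.

(** For small [s] the point [x - s z] is still in [U]; dividing by [s] gives the claim with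
    [t = 1 / s]. *)
Lemma opn_order_unit U x z : cone U -> opn U -> U x ->
  exists2 t : R, 0 < t & U (t *: x - z).
Proof.
move=> [_ UZ] oU /oU[e e0 eU]; pose s := e / (nrm z + 1).
have z0 := nrm_ge0 z; have s0 : 0 < s by rewrite divr_gt0 //; lra.
exists s^-1; first by rewrite invr_gt0.
rewrite (_ : _ - z = s^-1 *: (x - s *: z)).
  apply: UZ; rewrite ?invr_gt0 //; apply: eU.
  rewrite addrAC subrr sub0r nrmN nrmZ gtr0_norm // /s -mulrA gtr_pMr //.
  by rewrite mulrC ltr_pdivrMr; lra.
by rewrite scalerBr scalerA mulVf ?gt_eqF // scale1r.
Qed.

Lemma order_unit_mono U x z (s t : R) : cone U -> U x -> s <= t ->
  U (s *: x - z) -> U (t *: x - z).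
Proof.
move=> [UD UZ] Ux; rewrite le_eqVlt => /orP[/eqP -> //|st] Us.
rewrite (_ : _ - z = (s *: x - z) + (t - s) *: x).
  by apply: UD => //; apply: UZ => //; lra.
by mx_ring.
Qed.

End Generic.
End Cones.

(** * Common eigenvectors in a closed cone *)

Section Functional.
Variable R : realType.

Definition fv n (f : 'rV[R]_n) (x : 'cV[R]_n) : R := (f *m x) 0 0.

Lemma fvD n (f : 'rV[R]_n) x y : fv f (x + y) = fv f x + fv f y.
Proof. by rewrite /fv mulmxDr mxE. Qed.

Lemma fvN n (f : 'rV[R]_n) x : fv f (- x) = - fv f x.
Proof. by rewrite /fv mulmxN mxE. Qed.

Lemma fvZ n (f : 'rV[R]_n) c x : fv f (c *: x) = c * fv f x.
Proof. by rewrite /fv -scalemxAr mxE. Qed.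

End Functional.

Section EigenDecomposition.
Variables (R : realType) (n : nat) (f : 'rV[R]_n).
Variables (P : 'cV[R]_n -> Prop) (T : 'M[R]_n -> Prop).
Hypothesis P0 : P 0.
Hypothesis Pcone : cone P.
Hypothesis Pcls : forall x, cls P x -> P x.
Hypothesis Pf : forall x, P x -> x != 0 -> 0 < fv f x.
Hypothesis TP : forall a x, T a -> P x -> P (a *m x).
Hypothesis Tdom : forall a, T a ->
  exists2 t : R, 0 < t & forall x, P x -> P (t *: x - a *m x).

Definition eigvec (x : 'cV[R]_n) : Prop :=
  forall a, T a -> exists c : R, a *m x = c *: x.

Let PD x y : P x -> P y -> P (x + y). Proof. exact: (proj1 Pcone). Qed.

Let PZ c x : 0 <= c -> P x -> P (c *: x).
Proof.
rewrite le_eqVlt => /orP[/eqP <-|c0] Px; first by rewrite scale0r.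
exact: (proj2 Pcone).
Qed.

Let fv_ge0 x : P x -> 0 <= fv f x.
Proof.
by move=> Px; have [->|/(Pf Px)/ltW //] := eqVneq x 0; rewrite /fv mulmx0 mxE.
Qed.

(** The form [f] bounds the admissible [s] by [f x / f y], and closedness of [P] makes the supremum
    attained. *)
Lemma maximal_subtraction x y : P x -> P y -> y != 0 ->
  exists s : R, [/\ 0 <= s, P (x - s *: y) & forall s', P (x - s' *: y) -> s' <= s].
Proof.
move=> Px Py y0; have fy := Pf Py y0.
pose S : set R := fun s => 0 <= s /\ P (x - s *: y).
have S0 : S 0 by split=> //; rewrite scale0r subr0.
have ubS s : P (x - s *: y) -> s <= fv f x / fv f y.
  by move=> /fv_ge0; rewrite fvD fvN fvZ ler_pdivlMr // subr_ge0.
have hS : has_sup S by split; [exists 0|exists (fv f x / fv f y) => s [_ /ubS]].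
have s0 : 0 <= sup S by apply: ub_le_sup => //; exact: (proj2 hS).
exists (sup S); split=> //.
  apply: Pcls => e e0; have y1 : 0 < nrm y + 1 by have := nrm_ge0 y; lra.
  have [s [s_0 Ps] sS] := sup_adherent (divr_gt0 e0 y1) hS.
  exists (x - s *: y) => //.
  have sle : s <= sup S by apply: ub_le_sup; [exact: (proj2 hS)|].
  rewrite (_ : _ - _ = (sup S - s) *: y); last by mx_ring.
  rewrite nrmZ ger0_norm ?subr_ge0 //.
  have : (sup S - s) * (nrm y + 1) < e by rewrite -ltr_pdivlMr //; lra.
  by apply: le_lt_trans; rewrite ler_wpM2l ?subr_ge0 // lerDl.
move=> s' Ps'; have [s'0|/ltW s'0] := leP 0 s'; last exact: le_trans s'0 s0.
by apply: ub_le_sup; [exact: (proj2 hS)|split].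
Qed.

(** For points of [P], this says that [z] lies in the smallest face of [P] containing [x]. *)
Definition below x z : Prop := exists2 s : R, 0 < s & P (x - s *: z).

Let belowW x z (s s' : R) : P x -> 0 <= s' <= s -> P (x - s *: z) -> P (x - s' *: z).
Proof.
move=> Px /andP[s'0 s's] Ps; have [s0|s0] := eqVneq s 0.
  rewrite s0 in s's Ps; have /eqP -> // : s' == 0 by rewrite eq_le s's s'0.
have sp : 0 < s by lra.
rewrite (_ : _ - _ = (s' / s) *: (x - s *: z) + (1 - s' / s) *: x).
  apply: PD; apply: PZ => //; first by rewrite divr_ge0 // ltW.
  by rewrite subr_ge0 ler_pdivrMr ?mul1r.
by apply/matrixP => i j; rewrite !mxE; field.
Qed.

Let below_add x z z' : P x -> below x z -> below x z' -> below x (z + z').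
Proof.
move=> Px [s s0 Ps] [s' s'0 Ps']; pose r := Num.min s s'.
have r0 : 0 < r by rewrite lt_min s0 s'0.
have [rs rs'] : r <= s /\ r <= s' by rewrite !ge_min !lexx orbT.
have H1 : P (x - r *: z) by apply: belowW Ps => //; lra.
have H2 : P (x - r *: z') by apply: belowW Ps' => //; lra.
exists (r / 2); first by lra.
rewrite (_ : _ - _ = 2^-1 *: (x - r *: z) + 2^-1 *: (x - r *: z')).
  by apply: PD; apply: PZ => //; lra.
by apply/matrixP => i j; rewrite !mxE; field.
Qed.

Let below_scale x z c : P x -> P z -> below x z -> below x (c *: z).
Proof.
move=> Px Pz [s s0 Ps]; have [c0|c0] := leP c 0.
  exists 1 => //; rewrite scale1r -scaleNr; apply: PD => //; apply: PZ => //; lra.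
exists (s / c); first by rewrite divr_gt0.
by rewrite scalerA divfK // gt_eqF.
Qed.

Let below_span x (l : seq 'cV[R]_n) y : P x ->
  (forall z, z \in l -> P z /\ below x z) -> y \in <<l>>%VS -> below x y.
Proof.
move=> Px Hl yl; rewrite (coord_span (X := in_tuple l) yl).
apply: (big_ind (below x)) => [|z z'|i _].
- by exists 1 => //; rewrite scaler0 subr0.
- exact: below_add.
by have [] := Hl (in_tuple l)`_i (mem_nth _ (ltn_ord i)) => *; apply: below_scale.
Qed.

Let belowT x y z : P x -> P y -> P z -> below x y -> below y z -> below x z.
Proof.
move=> Px Py Pz [s s0 Ps] [r r0 Pr]; exists (s * r); first by rewrite mulr_gt0.
rewrite (_ : _ - _ = (x - s *: y) + s *: (y - r *: z)); last by mx_ring.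
by apply: PD => //; apply: PZ; rewrite ?ltW.
Qed.

(* If [a x] is not proportional to [x], subtracting from [a x] as much of [x] as possible, and
   then from [x] as much of the result [y] as possible, writes [x] as a sum of two elements that
   span strictly smaller faces of the cone. *)
Lemma sum_of_eigvec x : P x ->
  exists2 l : seq 'cV[R]_n, (forall w, w \in l -> P w /\ eigvec w) & x = \sum_(w <- l) w.
Proof.
(* Induction on the dimension of a subspace [U] containing the face of [x]. *)
suff H m : forall x (U : {vspace 'cV[R]_n}), (\dim U <= m)%N -> P x ->
    (forall y, P y -> below x y -> y \in U) ->
    exists2 l : seq 'cV[R]_n, (forall w, w \in l -> P w /\ eigvec w) & x = \sum_(w <- l) w.
  by move=> Px; apply: (H _ x fullv (leqnn _)) => // y _ _; exact: memvf.
have belowxx z : P z -> below z z.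
  by move=> Pz; exists 2^-1; [lra|rewrite (_ : _ - _ = 2^-1 *: z);
     [apply: PZ => //; lra|apply/matrixP => i j; rewrite !mxE; field]].
elim: m => [|m IHm] {}x U dU Px xU.
  exists [::] => //; rewrite big_nil.
  by move: dU; rewrite leqn0 dimv_eq0 => /eqP U0; have := xU x Px (belowxx _ Px);
     rewrite U0 memv0 => /eqP.
have [ex|/existsNP[a /not_implyP[Ta nax]]] := pselect (eigvec x).
  by exists [:: x]; rewrite ?big_seq1 // => w; rewrite inE => /eqP ->.
have x0 : x != 0 by apply/eqP => x0; apply: nax; exists 0; rewrite x0 mulmx0 scaler0.
have [r [r0 Py rmax]] := maximal_subtraction (TP Ta Px) Px x0.
set y := _ - _ in Py; have y0 : y != 0.
  by apply/eqP => /eqP; rewrite subr_eq0 => /eqP yx; apply: nax; exists r.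
(* Domination [a x <= t x] keeps [y] inside the face of [x]. *)
have bxy : below x y.
  have [t t0 Pt] := Tdom Ta; exists t^-1; first by rewrite invr_gt0.
  rewrite (_ : _ - _ = t^-1 *: (t *: x - a *m x) + (t^-1 * r) *: x).
    have t1 : 0 <= t^-1 by rewrite invr_ge0 ltW.
    by apply: PD; apply: PZ => //; [exact: Pt|exact: mulr_ge0].
  rewrite /y !scalerBr !scalerA mulVf ?gt_eqF // scale1r opprB addrA addrAC.
  by rewrite [_ - _ + _]addrC addrA.
have [s [s0 Px' smax]] := maximal_subtraction Px Py y0.
set x' := x - _ in Px' smax.
have bxx' : below x x'.
  exists 2^-1; first by lra.
  rewrite (_ : _ - _ = 2^-1 *: x + (2^-1 * s) *: y).
    by apply: PD; apply: PZ => //; [lra|apply: mulr_ge0 => //; lra].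
  by apply/matrixP => i j; rewrite !mxE; field.
(* If the face of [z] spanned all of [U], then [v] would be a combination of points below [z], hence
   itself below [z]. So a point [v] outside that face forces the dimension to drop. *)
have smaller z v : P z -> P v -> below x z -> below x v -> ~ below z v ->
    exists2 l : seq 'cV[R]_n, (forall w, w \in l -> P w /\ eigvec w) & z = \sum_(w <- l) w.
  move=> Pz Pv xz xv zv.
  have [l [lP _ ll]] := exists_spanning_subset (fun w => P w /\ below z w).
  apply: (IHm z <<l>>%VS) => //; last by move=> w Pw zw; apply: ll.
  have lU : (<<l>> <= U)%VS.
    by apply/span_subvP => w /lP[Pw zw]; apply: xU => //; apply: (@belowT x z w).
  rewrite -ltnS (leq_trans _ dU) // ltnNge; apply/negP => dl.
  have /eqP E : <<l>>%VS == U by rewrite eqEdim lU dl.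
  by apply: zv; apply: (@below_span z l) => //; rewrite E; apply: xU.
have [l1 l1P El1] : exists2 l : seq 'cV[R]_n,
    (forall w, w \in l -> P w /\ eigvec w) & x' = \sum_(w <- l) w.
  apply: (smaller x' y) => // -[s' s'0 Ps'].
  suff : s + s' <= s by lra.
  by apply: smax; rewrite (_ : _ - _ = x' - s' *: y) //; rewrite /x'; mx_ring.
have [l2 l2P El2] : exists2 l : seq 'cV[R]_n,
    (forall w, w \in l -> P w /\ eigvec w) & y = \sum_(w <- l) w.
  apply: (smaller y x) => // [|-[s' s'0 Ps']]; first exact: belowxx.
  suff : r + s' <= r by lra.
  by apply: rmax; rewrite (_ : _ - _ = y - s' *: x) // /y scalerDl opprD addrA.
exists (l1 ++ [seq s *: w | w <- l2]).
  move=> w; rewrite mem_cat => /orP[/l1P //|/mapP[w' /l2P[Pw' ew'] ->]].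
  split=> [|b /ew'[c bw]]; first exact: PZ.
  by exists c; rewrite -scalemxAr bw !scalerA mulrC.
by rewrite big_cat big_map /= -scaler_sumr -El1 -El2 /x' subrK.
Qed.

(* Caratheodory: a shortest decomposition uses linearly independent vectors. *)
Lemma independent_eigvec_sum x : P x ->
  exists (k : nat) (w : 'I_k -> 'cV[R]_n),
    [/\ forall i, P (w i) /\ eigvec (w i), x = \sum_i w i &
        forall c : 'I_k -> R, \sum_i c i *: w i = 0 -> forall i, c i = 0].
Proof.
move=> Px.
pose Q k := `[< exists w : 'I_k -> 'cV[R]_n,
  (forall i, P (w i) /\ eigvec (w i)) /\ x = \sum_i w i >].
have eigZ c w : 0 <= c -> P w /\ eigvec w -> P (c *: w) /\ eigvec (c *: w).
  move=> c0 [Pw ew]; split=> [|b /ew[d bw]]; first exact: PZ.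
  by exists d; rewrite -scalemxAr bw !scalerA mulrC.
have exQ : exists k, Q k.
  have [l lP xl] := sum_of_eigvec Px; exists (size l); apply/asboolP.
  exists (fun i => l`_i); split=> [i|]; first exact/lP/mem_nth.
  by rewrite xl (big_nth 0) big_mkord.
case: (ex_minnP exQ) => -[|k] /asboolP[w [wP xw]] kmin.
  by exists 0%N, w; split=> // c _ [].
exists k.+1, w; split=> // c c0; apply: contrapT => /existsNP[i0 ci0].
wlog ci_gt0 : c c0 i0 ci0 / 0 < c i0.
  move=> H; have [|cn|//] := ltgtP 0 (c i0); [exact: (H c c0 i0 ci0)| |by move=> E; apply: ci0].
  apply: (H (fun i => - c i) _ i0); rewrite ?oppr_gt0 //.
    by under eq_bigr do rewrite scaleNr; rewrite sumrN c0 oppr0.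
  by move=> /eqP; rewrite oppr_eq0 => /eqP.
pose i1 := [arg max_(i > i0) c i]%O.
have [ci1 cmax] : 0 < c i1 /\ forall i, c i <= c i1.
  rewrite /i1; case: arg_maxP => // j _ jmax; split=> [|i]; last exact: jmax.
  exact: lt_le_trans ci_gt0 (jmax _ _).
(* Subtracting the linear relation divided by its largest coefficient keeps all weights nonnegative
   and removes [w i1]. *)
pose d i := 1 - c i / c i1.
have d0 i : 0 <= d i by rewrite subr_ge0 ler_pdivrMr // mul1r.
have /kmin : Q k; last by rewrite ltnn.
apply/asboolP; exists (fun j => d (lift i1 j) *: w (lift i1 j)); split=> [j|].
  exact: eigZ.
have -> : x = \sum_i d i *: w i.
  rewrite (eq_bigr (fun i => w i - (c i1)^-1 *: (c i *: w i))); last first.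
    by move=> i _; rewrite /d scalerBl scale1r scalerA mulrC.
  by rewrite sumrB -scaler_sumr c0 scaler0 subr0.
by rewrite (bigD1_ord i1) //= /d divff ?gt_eqF // subrr scale0r add0r.
Qed.

End EigenDecomposition.

(** * Co-compact action of a maximal abelian group on an invariant cone *)

Ltac vec_ring :=
  rewrite ?mulmxBr ?mulmxDr -?scalemxAr -?mulmxA;
  repeat match goal with |- context [@mulmx ?T ?m ?n ?p ?a ?b] =>
    let X := fresh "X" in set X := (@mulmx T m n p a b); clearbody X end;
  apply/matrixP => ? ?; rewrite !mxE; ring.

Lemma uniform_constant (R : realType) (X : eqType) (l : seq X) (Q : X -> R -> Prop) :
  (forall x s t, s <= t -> Q x s -> Q x t) ->
  (forall x, x \in l -> exists t, Q x t) ->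
  exists2 t : R, 0 < t & forall x, x \in l -> Q x t.
Proof.
move=> Qmono; elim: l => [|y l IHl] H; first by exists 1.
have [t Qt] := H y (mem_head _ _).
have [|t' t'0 Qt'] := IHl; first by move=> x xl; apply: H; rewrite inE xl orbT.
exists (Num.max t t'); first by rewrite lt_max t'0 orbT.
move=> x; rewrite inE => /orP[/eqP ->|/Qt' Q'].
  by apply: Qmono Qt; rewrite le_max lexx.
by apply: Qmono Q'; rewrite le_max lexx orbT.
Qed.

Section Core.
Variables (R : realType) (n : nat) (f : 'rV[R]_n.+1) (Mb : R).
Variables (Om C : 'cV[R]_n.+1 -> Prop) (L A : 'M[R]_n.+1 -> Prop).
Hypothesis Om_cone : cone Om.
Hypothesis Om_opn : opn Om.
Hypothesis Om_gt0 : forall x, Om x -> 0 < fv f x.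
Hypothesis Mb_ge0 : 0 <= Mb.
Hypothesis Om_bnd : forall x, Om x -> nrm x <= Mb * fv f x.
Hypothesis L_unit : forall g, L g -> g \in unitmx.
Hypothesis L_mul : forall g h, L g -> L h -> L (g *m h).
Hypothesis L_inv : forall g, L g -> L (invmx g).
Hypothesis L_Om : forall g x, L g -> Om x -> Om (g *m x).
Hypothesis L_discrete : exists2 e : R, 0 < e &
  forall g, L g -> nrm (g - 1%:M) < e -> exists c : R, g = c%:M.

Let OmD x y : Om x -> Om y -> Om (x + y). Proof. exact: (proj1 Om_cone). Qed.
Let OmZ c x : 0 < c -> Om x -> Om (c *: x). Proof. exact: (proj2 Om_cone). Qed.

Lemma order_coef_gt0 u z c : Om u -> Om z -> Om (c *: u - z) -> 0 < c.
Proof.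
move=> Ou Oz /Om_gt0; rewrite fvD fvN fvZ => H.
have := Om_gt0 Ou; have := Om_gt0 Oz => z0 u0.
by rewrite -(pmulr_lgt0 _ u0); lra.
Qed.

(** Every [z] satisfies [- t u <= z] and [t u + z <= s u]; applying [g] bounds [f] on two vectors of
    [Om] whose combination is [g z], and on [Om] the form [f] controls the norm. Taking for [z] the
    standard basis bounds all columns of [g]. *)
Lemma bounded_of_order_bounded u : Om u -> exists2 B : R, 0 <= B &
  forall g c, L g -> Om (c *: u - g *m u) -> nrm g <= B * c.
Proof.
move=> Ou; have Hz (z : 'cV[R]_n.+1) : exists B : R, 0 <= B /\
    forall g c, L g -> Om (c *: u - g *m u) -> nrm (g *m z) <= B * c.
  have [t t0 Ot] := opn_order_unit (- z) Om_cone Om_opn Ou.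
  have [s s0 Os] := opn_order_unit (t *: u + z) Om_cone Om_opn Ou.
  rewrite opprK in Ot; have fu := Om_gt0 Ou.
  exists (Mb * (s + t) * fv f u); split.
    by rewrite !mulr_ge0 // ?addr_ge0 // ltW.
  move=> g c Lg Og; have c0 := order_coef_gt0 Ou (L_Om Lg Ou) Og.
  rewrite (_ : g *m z = g *m (t *: u + z) - t *: (g *m u)); last by vec_ring.
  apply: le_trans (nrmD _ _) _; rewrite nrmN nrmZ gtr0_norm //.
  have b1 := Om_bnd (L_Om Lg Ot); have b2 := Om_bnd (L_Om Lg Ou).
  have h2 : Mb * fv f (g *m u) <= Mb * (c * fv f u).
    by apply: ler_wpM2l => //; have := Om_gt0 Og; rewrite fvD fvN fvZ; lra.
  have h1 : Mb * fv f (g *m (t *: u + z)) <= Mb * (s * (c * fv f u)).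
    apply: ler_wpM2l => //; have := Om_gt0 (L_Om Lg Os); have := Om_gt0 (OmZ s0 Og).
    rewrite mulmxBr -scalemxAr !(fvD, fvN, fvZ) => h3 h4.
    by move: h3 h4; set X := fv f (g *m u); set Y := fv f (_ *m _); lra.
  have h3 : t * nrm (g *m u) <= t * (Mb * (c * fv f u)).
    by apply: ler_wpM2l; [exact: ltW|exact: le_trans b2 h2].
  rewrite (_ : _ * c = Mb * (s * (c * fv f u)) + t * (Mb * (c * fv f u))); last by ring.
  by apply: lerD => //; exact: le_trans b1 h1.
have [B HB] := choice Hz.
exists (\sum_j B (delta_mx j 0)); first by apply: sumr_ge0 => j _; case: (HB (delta_mx j 0)).
move=> g c Lg Og; rewrite mulr_suml /nrm exchange_big /=.
apply: ler_sum => j _; apply: le_trans (proj2 (HB (delta_mx j 0)) g c Lg Og).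
rewrite -colE /nrm; apply: ler_sum => i _; rewrite big_ord1 mxE; exact: lexx.
Qed.

(** Applying [g] to the last condition yields [u <= c (g u)]: a bounded displacement of [u], in
    direction and in scale. *)
Definition ordbnd u (c : R) g : Prop :=
  [/\ L g, Om (c *: u - g *m u) & Om (c *: u - invmx g *m u)].

(** Proper discontinuity: two elements with the same key are so close, and their inverses so
    bounded, that their quotient enters the neighbourhood of the identity where discreteness leaves
    only scalars. *)
Lemma ordbnd_finite_key u c : Om u ->
  exists (T : finType) (key : 'M[R]_n.+1 -> T), forall g h,
    ordbnd u c g -> ordbnd u c h -> key g = key h -> exists s, g = s *: h.
Proof.
move=> Ou; have [B B0 HB] := bounded_of_order_bounded Ou.
have [e e0 He] := L_discrete.
have B1 : 0 < B * `|c| + 1 by apply: ltr_wpDl => //; apply: mulr_ge0.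
have [T [key Hkey]] := @bounded_matrices_finite_key R n.+1 n.+1 (B * c) _ (divr_gt0 e0 B1).
exists T, key => g h [Lg g1 g2] [Lh h1 h2] gh.
have /Hkey/(_ (HB _ _ Lh h1) gh) d := HB _ _ Lg g1.
have uh := L_unit Lh.
have [||s Es] := He (invmx h *m g); first by apply: L_mul => //; apply: L_inv.
  rewrite (_ : _ - _ = invmx h *m (g - h)); last by rewrite mulmxBr mulVmx.
  apply: le_lt_trans (nrmM _ _) _; have b := HB _ _ (L_inv Lh) h2.
  rewrite ltr_pdivlMr // mulrC in d; apply: le_lt_trans d.
  apply: ler_wpM2r; rewrite ?nrm_ge0 // (le_trans b) //.
  by apply: ler_wpDr => //; apply: ler_wpM2l => //; exact: ler_norm.
by exists s; rewrite -[g](mulKVmx uh) Es -scalemx1 -scalemxAr mulmx1.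
Qed.

(** Positivity of [f] on [Om] gives [s > 0], and determinants give [s ^ n.+1 = 1], whence
    [s = 1]. *)
Lemma projectively_commuting u g h s : Om u -> L g -> L h ->
  g *m h = s *: (h *m g) -> g *m h = h *m g.
Proof.
move=> Ou Lg Lh E.
have s0 : 0 < s.
  have := Om_gt0 (L_Om (L_mul Lg Lh) Ou); have := Om_gt0 (L_Om (L_mul Lh Lg) Ou).
  by rewrite E -scalemxAl fvZ => h1; rewrite pmulr_lgt0.
have := congr1 determinant E; rewrite detZ !det_mulmx [\det h * _]mulrC => /eqP.
rewrite -[X in X == _]mul1r eq_sym (inj_eq (mulIf _)); last first.
  by rewrite mulf_neq0 // -unitfE -unitmxE L_unit.
by rewrite pexprn_eq1 ?(ltW s0) //= => /eqP s1; rewrite E s1 scale1r.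
Qed.

Hypothesis C_Om : forall x, C x -> Om x.
Hypothesis C_cone : cone C.
Hypothesis C_cls : forall x, Om x -> cls C x -> C x.
Hypothesis C_ex : exists x, C x.
Hypothesis L_C : forall g x, L g -> C x -> C (g *m x).
Variable u : 'cV[R]_n.+1.
Hypothesis Om_u : Om u.
Hypothesis L_cobounded : exists c : R, forall x, C x ->
  exists g, [/\ L g, Om (c *: u - g *m x) & Om (c *: (g *m x) - u)].
Hypothesis A_L : forall a, A a -> L a.
Hypothesis A_comm : forall a b, A a -> A b -> a *m b = b *m a.
Hypothesis A_max : forall b, L b -> (forall a, A a -> b *m a = a *m b) -> A b.

Definition invariant_cone (E : 'cV[R]_n.+1 -> Prop) : Prop :=
  [/\ exists x, E x, forall x, E x -> C x, cone E,
      forall a x, A a -> E x -> E (a *m x) & forall x, Om x -> cls E x -> E x].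

Lemma exists_cobounded_invariant_cone : exists2 D, invariant_cone D &
  exists2 c : R, 0 < c & forall x, D x ->
  exists a, [/\ A a, Om (c *: u - a *m x) & Om (c *: (a *m x) - u)].
Proof.
have [l [lA _ lspan]] := exists_spanning_subset A.
have [x0 Cx0] := C_ex; have Ox0 := C_Om Cx0.
(* The inequalities are taken in the closure of [Om], so that the cone they cut out is closed in
   [Om]. The constant [s] comes from an arbitrary point [x0], which makes that cone non-empty. *)
pose Q (a : 'M[R]_n.+1) s x := cls Om (s *: x - a *m x) /\ cls Om (s *: (a *m x) - x).
have [s s0 Qs] : exists2 s : R, 0 < s & forall a, a \in l -> A a -> Q a s x0.
  apply: (@uniform_constant R _ l (fun a s => A a -> Q a s x0)).
    move=> a s t st H Aa; have [q1 q2] := H Aa.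
    have mono y z : Om y -> cls Om (s *: y - z) -> cls Om (t *: y - z).
      move=> Oy; rewrite le_eqVlt in st; case/orP: st => [/eqP -> //|st] K.
      rewrite (_ : _ - _ = (s *: y - z) + (t - s) *: y); last by mx_ring.
      by apply: cls_add => //; apply: sub_cls; apply: OmZ => //; lra.
    by split; apply: mono => //; apply: L_Om => //; exact: A_L.
  move=> a al; have Oax := L_Om (A_L (lA _ al)) Ox0.
  have [t t0 Ot] := opn_order_unit (a *m x0) Om_cone Om_opn Ox0.
  have [r r0 Or] := opn_order_unit x0 Om_cone Om_opn Oax.
  exists (Num.max t r) => _; split; apply: sub_cls; last first.
    by apply: order_unit_mono Or => //; rewrite le_max lexx orbT.
  by apply: order_unit_mono Ot => //; rewrite le_max lexx.
pose D x := C x /\ forall a, a \in l -> Q a s x.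
have Dinv : invariant_cone D.
  split.
  - by exists x0; split=> // a al; apply: Qs => //; exact: lA.
  - by move=> x [].
  - split=> [x y [Cx Dx] [Cy Dy]|c x c0 [Cx Dx]]; split.
    + exact: (proj1 C_cone).
    + move=> a al; have [[x1 x2] [y1 y2]] := (Dx a al, Dy a al); split.
        rewrite (_ : _ - _ = (s *: x - a *m x) + (s *: y - a *m y)); last by vec_ring.
        exact: cls_add.
      rewrite (_ : _ - _ = (s *: (a *m x) - x) + (s *: (a *m y) - y)); last by vec_ring.
      exact: cls_add.
    + exact: (proj2 C_cone).
    + move=> a al; have [x1 x2] := Dx a al; split.
        rewrite (_ : _ - _ = c *: (s *: x - a *m x)); last by vec_ring.
        exact: cls_scale.
      rewrite (_ : _ - _ = c *: (s *: (a *m x) - x)); last by vec_ring.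
      exact: cls_scale.
  - move=> a x Aa [Cx Dx]; split; first by apply: L_C => //; exact: A_L.
    move=> b bl; have [x1 x2] := Dx b bl; have ab := A_comm Aa (lA _ bl).
    have cl y : cls Om y -> cls Om (a *m y).
      by apply: cls_lin => z Oz; apply: L_Om => //; exact: A_L.
    split; rewrite mulmxA -ab -mulmxA.
      by rewrite (_ : _ - _ = a *m (s *: x - b *m x)); [exact: cl|vec_ring].
    by rewrite (_ : _ - _ = a *m (s *: (b *m x) - x)); [exact: cl|vec_ring].
  - move=> x Ox clx; split; first by apply: C_cls => //; apply: clsS clx => y [].
    move=> a al; split; apply: clsK.
      rewrite (_ : _ - _ = (s%:M - a) *m x); last by rewrite mulmxBl mul_scalar_mx.
      apply: cls_lin clx => y [_ /(_ a al)[y1 _]].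
      by rewrite mulmxBl mul_scalar_mx.
    rewrite (_ : _ - _ = (s *: a - 1%:M) *m x); last by rewrite mulmxBl mul1mx scalemxAl.
    apply: cls_lin clx => y [_ /(_ a al)[_ y2]].
    by rewrite mulmxBl mul1mx -scalemxAl.
exists D => //.
have [c Hc] := L_cobounded.
(* The chain [g b g^-1 u <= c (g b x) <= c s (g x) <= c s c u]: bounded displacement at [x] becomes
   bounded displacement of the conjugate at [u]. *)
have conj_bnd g b x : L g -> L b -> Om x -> Om (c *: u - g *m x) -> Om (c *: (g *m x) - u) ->
    cls Om (s *: x - b *m x) -> Om ((c * s * c) *: u - g *m b *m invmx g *m u).
  move=> Lg Lb Ox g1 g2 bx; have ug := L_unit Lg.
  have c0 := order_coef_gt0 Om_u (L_Om Lg Ox) g1.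
  rewrite (_ : _ - _ = c *: (g *m (s *: x - b *m x)) +
     ((c * s) *: (c *: u - g *m x) + g *m (b *m (invmx g *m (c *: (g *m x) - u))))); last first.
    by rewrite (mulmxBr (invmx g)) -(scalemxAr c (invmx g)) mulKmx //; vec_ring.
  apply: cls_opn_add => //.
    apply: cls_scale => //; apply: cls_lin bx => y; exact: L_Om.
  by apply: OmD; [apply: OmZ => //; apply: mulr_gt0|do 3!apply: L_Om => //; exact: L_inv].
pose Pg g := L g /\ exists2 x, D x & Om (c *: u - g *m x) /\ Om (c *: (g *m x) - u).
have [T [key Hkey]] := @ordbnd_finite_key u (c * s * c) Om_u.
pose key' (g : 'M[R]_n.+1) := [ffun i : 'I_(size l) => key (g *m l`_i *m invmx g)].
have [lg lgP Hlg] := fiber_representatives key' Pg.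
have conj_ordbnd g a : Pg g -> a \in l -> ordbnd u (c * s * c) (g *m a *m invmx g).
  move=> [Lg [x [Cx Dx] [g1 g2]]] al; have La := A_L (lA _ al).
  have [q1 q2] := Dx a al; have Ox := C_Om Cx.
  have [ug ua] := (L_unit Lg, L_unit La); have Lig := L_inv Lg.
  split; [by do 2!apply: L_mul => //|exact: (conj_bnd g a x)|].
  have -> : invmx (g *m a *m invmx g) = g *m invmx a *m invmx g.
    apply: (can_inj (mulKmx (_ : g *m a *m invmx g \in unitmx))); last first.
      by rewrite mulmxV ?unitmx_mul ?ug ?ua ?unitmx_inv // !mulmxA !mulmxKV ?mulmxK ?mulmxV.
    by rewrite !unitmx_mul ug ua unitmx_inv.
  apply: (conj_bnd g (invmx a) x) => //; first exact: L_inv.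
  rewrite (_ : _ - _ = invmx a *m (s *: (a *m x) - x)).
    by apply: cls_lin q2 => y; apply: L_Om; exact: L_inv.
  by rewrite mulmxBr -scalemxAr mulKmx.
(* The finitely many representatives move [u] by a bounded amount, which is the price of replacing
   [g] by [h^-1 g] below. *)
have [t t0 Ht] : exists2 t : R, 0 < t & forall g, g \in lg -> L g ->
    Om (t *: u - invmx g *m u) /\ Om (t *: (invmx g *m u) - u).
  apply: (@uniform_constant R _ lg (fun g t => L g ->
    Om (t *: u - invmx g *m u) /\ Om (t *: (invmx g *m u) - u))).
    move=> g r t rt H Lg; have [h1 h2] := H Lg.
    split; first exact: order_unit_mono h1.
    by apply: order_unit_mono h2 => //; apply: L_Om => //; exact: L_inv.
  move=> g /lgP[Lg _]; have Ogu := L_Om (L_inv Lg) Om_u.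
  have [t t0 Ot] := opn_order_unit (invmx g *m u) Om_cone Om_opn Om_u.
  have [r r0 Or] := opn_order_unit u Om_cone Om_opn Ogu.
  exists (Num.max t r) => _; split; last first.
    by apply: order_unit_mono Or => //; rewrite le_max lexx orbT.
  by apply: order_unit_mono Ot => //; rewrite le_max lexx.
have c0 : 0 < c.
  have [g [Lg g1 _]] := Hc _ Cx0; exact: order_coef_gt0 Om_u (L_Om Lg Ox0) g1.
exists (c * t); first exact: mulr_gt0.
move=> x Dx; have [g [Lg g1 g2]] := Hc _ (proj1 Dx).
have Pgg : Pg g by split=> //; exists x.
have [h hl hg] := Hlg g Pgg; have Pgh := lgP _ hl; have [Lh _] := Pgh.
have [uh ug] := (L_unit Lh, L_unit Lg).
(* [g] and [h] conjugate each [a] of [l] to the same matrix up to a scalar, so [b] commutes with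
   [l], hence with [A], and maximality puts it in [A]. *)
pose b := invmx h *m g; have Lb : L b by apply: L_mul => //; exact: L_inv.
have bl a : a \in l -> b *m a = a *m b.
  move=> al; have [i il ai] : exists2 i, (i < size l)%N & a = l`_i.
    by exists (index a l); rewrite ?index_mem // nth_index.
  have [|s1 E] := Hkey _ _ (conj_ordbnd _ _ Pgg al) (conj_ordbnd _ _ Pgh al).
    by move/ffunP: hg => /(_ (Ordinal il)); rewrite !ffunE /= -ai => ->.
  apply: (projectively_commuting (s := s1) Om_u) => //; first exact/A_L/lA.
  rewrite /b; have -> : invmx h *m g *m a = invmx h *m (g *m a *m invmx g) *m g.
    by rewrite !mulmxA mulmxKV.
  by rewrite E -scalemxAr -scalemxAl !mulmxA mulVmx // mul1mx.
exists b; split.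
- apply: A_max => // a /lspan al.
  rewrite (coord_span (X := in_tuple l) al) mulmx_sumr mulmx_suml.
  apply: eq_bigr => i _; rewrite -scalemxAr -scalemxAl bl //.
  exact: (mem_nth _ (ltn_ord i)).
- have [h1 _] := Ht _ hl Lh.
  rewrite (_ : _ - _ = c *: (t *: u - invmx h *m u) + invmx h *m (c *: u - g *m x)).
    by apply: OmD; [exact: OmZ|apply: L_Om => //; exact: L_inv].
  by rewrite /b; vec_ring.
- have [_ h2] := Ht _ hl Lh.
  rewrite (_ : _ - _ = t *: (invmx h *m (c *: (g *m x) - u)) + (t *: (invmx h *m u) - u)).
    by apply: OmD => //; apply: OmZ => //; apply: L_Om => //; exact: L_inv.
  by rewrite /b; vec_ring.
Qed.

End Core.

(** * Minimal invariant cones *)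

Lemma cls_fv_ge0 (R : realType) n (f : 'rV[R]_n) (D : 'cV[R]_n -> Prop) x :
  (forall y, D y -> 0 <= fv f y) -> cls D x -> 0 <= fv f x.
Proof.
move=> fD clx; have H := @cls_lin _ _ D 1 (fun z => 0 <= z 0 0) f x fD clx.
apply/ler_addgt0Pr => e e0; have [y y0 ye] := H e e0.
have := le_lt_trans (entry_le_nrm _ 0 0) ye; rewrite 2!mxE ltr_norml.
by rewrite -/(fv f x) => /andP[_]; move: y0; lra.
Qed.

Lemma row_mul_matrix (F : fieldType) (k m : nat) (w : 'I_k -> 'cV[F]_m) (c : 'I_k -> F) :
  (\row_i c i) *m (\matrix_(i < k, j < m) w i j 0) = (\sum_i c i *: w i)^T.
Proof.
apply/matrixP => i j; rewrite !mxE summxE; apply: eq_bigr => l _.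
by rewrite !mxE ord1.
Qed.

Lemma row_free_of_independent (F : fieldType) (k m : nat) (w : 'I_k -> 'cV[F]_m) :
  (forall c : 'I_k -> F, \sum_i c i *: w i = 0 -> forall i, c i = 0) ->
  row_free (\matrix_(i < k, j < m) w i j 0).
Proof.
move=> w_ind; rewrite -kermx_eq0; apply/eqP/row_matrixP => i; rewrite row0.
set W := (\matrix_(i, j) _); have : row i (kermx W) *m W = 0 by rewrite -row_mul mulmx_ker row0.
move: (row i _) => v vW; have vE : v = \row_j v 0 j.
  by apply/matrixP => i' j; rewrite mxE ord1.
apply/matrixP => i' j; rewrite ord1 mxE; apply: (w_ind (fun j => v 0 j)).
by apply: trmx_inj; rewrite -row_mul_matrix -vE vW trmx0.
Qed.

(** Dual forms to an independent family, read off a one-sided inverse. Being defined on the whole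
    space, they allow coordinate conditions to be passed to closures. *)
Lemma linear_coordinates (R : realType) (n k : nat) (w : 'I_k -> 'cV[R]_n) :
  (forall c : 'I_k -> R, \sum_i c i *: w i = 0 -> forall i, c i = 0) ->
  exists phi : 'I_k -> 'rV[R]_n, forall (c : 'I_k -> R) i,
    fv (phi i) (\sum_j c j *: w j) = c i.
Proof.
move=> w_ind; have Wf := row_free_of_independent w_ind; set W := (\matrix_(i, j) _) in Wf.
exists (fun i => row i (pinvmx W)^T) => c i.
have -> : \sum_j c j *: w j = W^T *m (\row_j c j)^T.
  by apply: trmx_inj; rewrite -row_mul_matrix trmx_mul !trmxK.
by rewrite /fv mulmxA -row_mul -trmx_mul mulmxVp // trmx1 -row_mul mul1mx !mxE.
Qed.

Lemma cls_eq0 (R : realType) m (z : 'cV[R]_m) : cls (fun y => y = 0) z -> z = 0.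
Proof.
move=> clz; have z0 : nrm z <= 0.
  apply/ler_addgt0Pr => e e0; have [y -> ye] := clz e e0.
  by rewrite add0r ltW // -nrmN -sub0r.
apply/matrixP => i j; rewrite mxE; apply/eqP.
by rewrite -normr_le0 (le_trans _ z0) // entry_le_nrm.
Qed.

Section MinimalCone.
Variables (R : realType) (n : nat) (f : 'rV[R]_n.+1) (Mb : R).
Variables (Om C : 'cV[R]_n.+1 -> Prop) (A : 'M[R]_n.+1 -> Prop).
Hypothesis Om_cone : cone Om.
Hypothesis Om_opn : opn Om.
Hypothesis Om_gt0 : forall x, Om x -> 0 < fv f x.
Hypothesis Mb_ge0 : 0 <= Mb.
Hypothesis Om_bnd : forall x, Om x -> nrm x <= Mb * fv f x.
Hypothesis C_Om : forall x, C x -> Om x.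
Hypothesis A_unit : forall a, A a -> a \in unitmx.
Hypothesis A_Om : forall a x, A a -> Om x -> Om (a *m x).
Hypothesis A_comm : forall a b, A a -> A b -> a *m b = b *m a.
Let OmD x y : Om x -> Om y -> Om (x + y). Proof. exact: (proj1 Om_cone). Qed.
Let OmZ c x : 0 < c -> Om x -> Om (c *: x). Proof. exact: (proj2 Om_cone). Qed.

Local Notation invc := (invariant_cone Om C A).

Lemma cls_bnd x : cls Om x -> nrm x <= Mb * fv f x.
Proof.
move=> clx; apply/ler_addgt0Pr => e e0.
pose K := Mb * nrm f + 1; have f0 := nrm_ge0 f.
have K0 : 0 < K by rewrite ltr_wpDl // mulr_ge0.
have [y Oy yx] := clx _ (divr_gt0 e0 K0); rewrite ltr_pdivlMr // in yx.
have h1 : nrm x <= nrm y + nrm (y - x).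
  by rewrite nrmBC {1}(_ : x = y + (x - y)) ?nrmD //; mx_ring.
have h2 : fv f y - fv f x <= nrm f * nrm (y - x).
  rewrite -fvN -fvD; apply: le_trans (nrmM _ _).
  exact: le_trans (ler_norm _) (entry_le_nrm _ _ _).
have h3 := Om_bnd Oy.
have h4 : Mb * (fv f y - fv f x) <= Mb * (nrm f * nrm (y - x)) by exact: ler_wpM2l.
by move: yx h4; rewrite /K mulrDr mulrBr mulr1 mulrA [_ * (Mb * _)]mulrC; lra.
Qed.

Lemma cls_gt0 x : cls Om x -> x != 0 -> 0 < fv f x.
Proof.
move=> /[dup] clx /cls_bnd xb; apply: contraNT; rewrite -leNgt => fx.
have x0 : nrm x <= 0 by rewrite (le_trans xb) // mulr_ge0_le0.
apply/eqP/matrixP => i j; rewrite mxE; apply/eqP.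
by rewrite -normr_le0 (le_trans _ x0) // entry_le_nrm.
Qed.

(** The order interval [u / c <= x <= c u]. Its lower bound keeps it away from the boundary, so it
    lies in [Om] although it is cut out by closed conditions; its upper bound and [f] bound the
    norm. *)
Lemma order_box_compact u c : 0 < c -> Om u ->
  exists2 K : 'cV[R]_n.+1 -> Prop,
    [/\ forall x, K x -> Om x, forall x, cls K x -> K x &
        exists M : R, forall x, K x -> nrm x <= M] &
    forall x, Om (c *: u - x) -> Om (c *: x - u) -> K x.
Proof.
move=> c0 Ou.
exists (fun x => cls Om (c *: u - x) /\ cls Om (c *: x - u)); last first.
  by move=> x *; split; exact: sub_cls.
have KO x : cls Om (c *: x - u) -> Om x.
  move=> h; rewrite (_ : x = c^-1 *: ((c *: x - u) + u)).
    by apply: OmZ; rewrite ?invr_gt0 //; exact: cls_opn_add.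
  by rewrite subrK scalerA mulVf ?scale1r // gt_eqF.
split=> [x []||]; first by move=> _; exact: KO.
  move=> x clx.
  have sh (y z : 'cV[R]_n.+1) D E : (forall v, D v -> E (y + v)) -> cls D z -> cls E (y + z).
    move=> DE Dz e e0; have [v Dv vz] := Dz e e0; exists (y + v); first exact: DE.
    by rewrite opprD addrACA subrr add0r.
  split; apply: clsK.
    apply: (sh _ _ (fun v => cls Om (c *: u + v))) => //.
    rewrite -scaleN1r -(mul_scalar_mx (-1)); apply: cls_lin clx => y [].
    by rewrite mul_scalar_mx scaleN1r.
  rewrite addrC; apply: (sh _ _ (fun v => cls Om (- u + v))) => //.
  rewrite -(mul_scalar_mx c x); apply: cls_lin clx => y [_].
  by rewrite mul_scalar_mx addrC.
exists (Mb * (c * fv f u)) => x [h1 /KO Ox]; apply: le_trans (Om_bnd Ox) _.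
apply: ler_wpM2l => //; have := cls_fv_ge0 (fun y Oy => ltW (Om_gt0 Oy)) h1.
by rewrite fvD fvN fvZ; lra.
Qed.

Section Existence.
Variables (D0 : 'cV[R]_n.+1 -> Prop) (u : 'cV[R]_n.+1) (c0 : R).
Hypothesis c0_gt0 : 0 < c0.
Hypothesis Om_u : Om u.
Hypothesis D0_inv : invc D0.
Hypothesis D0_cob : forall x, D0 x ->
  exists a, [/\ A a, Om (c0 *: u - a *m x) & Om (c0 *: (a *m x) - u)].

(** Zorn's lemma for reverse inclusion. The point is that a chain has non-empty intersection: by
    [D0_cob] every member meets one compact order interval [K], and the members are closed in
    [Om]. *)
Lemma exists_minimal_cone : exists D, [/\ invc D, forall x, D x -> D0 x &
  forall E, invc E -> (forall x, E x -> D x) -> forall x, D x -> E x].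
Proof.
pose T := {E : 'cV[R]_n.+1 -> Prop | invc E /\ forall x, E x -> D0 x}.
pose le (E F : T) := `[< forall x, sval F x -> sval E x >].
pose t0 : T := exist _ D0 (conj D0_inv (fun x h => h)).
have [| |F Ftot|[D [Dinv DD0]] Dmax] := @ZL_preorder T t0 le.
- by move=> E; apply/asboolP.
- by move=> E F G /asboolP EF /asboolP FG; apply/asboolP => x /FG/EF.
- have [[E0 FE0]|FN] := pselect (exists E, F E); last first.
    by exists t0 => E FE; case: FN; exists E.
  pose I x := forall E, F E -> sval E x.
  have [[x Ix]|IN] := pselect (exists x, I x).
    suff iI : invc I /\ forall x, I x -> D0 x.
      by exists (exist _ I iI) => E FE; apply/asboolP => y; apply.
    have IE E y : F E -> I y -> sval E y by move=> FE; apply.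
    split; last by move=> y /(IE _ _ FE0); case: (E0) => E [? HE] /=; exact: HE.
    split; first by exists x.
    + by move=> y /(IE _ _ FE0); case: (E0) => E [[_ HE _ _ _] _] /=; exact: HE.
    + split=> [y z Iy Iz E FE|d y d0 Iy E FE]; have := IE _ _ FE Iy;
        last by case: (E) => E' [[_ _ [_ H] _ _] _] /= ; exact: H.
      by have := IE _ _ FE Iz; case: (E) => E' [[_ _ [H _] _ _] _] /= ? ?; exact: H.
    + move=> a y Aa Iy E FE; have := IE _ _ FE Iy.
      by case: (E) => E' [[_ _ _ H _] _] /=; exact: H.
    + move=> y Oy cly E FE; have : cls (sval E) y by apply: clsS cly => z /(IE _ _ FE).
      by case: (E) => E' [[_ _ _ _ H] _] /=; exact: H.
  (* With an empty intersection, the complements of the closures of the members would cover [K]. *)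
  exfalso; have [K [KO Kcl [M KM]] Kbox] := order_box_compact c0_gt0 Om_u.
  have [E y|y Ky|l Hl] := @heine_borel R _ K M {E | F E}
    (fun E y => ~ cls (sval (sval E)) y) KM Kcl.
  + move=> /existsNP[e /not_implyP[e0 He]]; exists (e / 2); first by lra.
    move=> z zy cz; apply: He; have [|v Ev vz] := cz (e / 2); first by lra.
    exists v => //; rewrite (_ : v - y = (v - z) + (z - y)); last by mx_ring.
    by apply: le_lt_trans (nrmD _ _) _; lra.
  + have /existsNP[E /not_implyP[FE nEy]] : ~ I y by move=> Iy; apply: IN; exists y.
    exists (exist _ E FE) => /= cly; apply: nEy.
    by case: (E) cly => E' [[_ _ _ _ H] _] /=; apply: H; exact: KO.
  (* The smallest of the finitely many members in the subcover; some translate of one of its points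
     lies in [K], yet no complement contains it. *)
  have [E FE El] : exists2 E, F E & forall G, List.In G l -> forall x, sval E x -> sval (sval G) x.
    elim: l {Hl} => [|[G FG] l [E FE El]]; first by exists E0.
    have [/asboolP|/asboolP] := Ftot _ _ FE FG => EG; last first.
      by exists E => // G' [<-|/El].
    by exists G => // G' [<- //|/El H] x /EG/H.
  have [x Ex] : exists x, sval E x by case: (E) => E' [[]].
  have ED : D0 x by case: (E) Ex => E' [_ H] /= /H.
  have [a [Aa a1 a2]] := D0_cob ED.
  have Eax : sval E (a *m x) by case: (E) Ex => E' [[_ _ _ H _] _] /=; exact: H.
  by have [G Gl] := Hl _ (Kbox _ a1 a2); apply; apply: sub_cls; exact: El.
exists D; split=> // E Einv ED.
have ED0 : invc E /\ forall x, E x -> D0 x by split=> // x /ED/DD0.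
by have /asboolP := Dmax (exist _ E ED0) (introT (asboolP _) ED).
Qed.

End Existence.

Variable D : 'cV[R]_n.+1 -> Prop.
Hypothesis D_inv : invc D.
Hypothesis D_min : forall E, invc E -> (forall x, E x -> D x) -> forall x, D x -> E x.

Let D_cone : cone D. Proof. by case: D_inv. Qed.
Let D_Om x : D x -> Om x. Proof. by case: D_inv => _ DC _ _ _ /DC/C_Om. Qed.
Let D_A a x : A a -> D x -> D (a *m x). Proof. by case: D_inv => _ _ _ H _; exact: H. Qed.
Let D_cls x : Om x -> cls D x -> D x. Proof. by case: D_inv => _ _ _ _; apply. Qed.
Let clsD_cone : cone (cls D). Proof. exact: cone_cls. Qed.
Let clsD_A a x : A a -> cls D x -> cls D (a *m x).
Proof. by move=> Aa; apply: cls_lin => y; exact: D_A. Qed.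

Let clsD0 : cls D 0.
Proof.
have [[x Dx] _ _ _ _] := D_inv; move=> e e0.
have x1 : 0 < nrm x + 1 by have := nrm_ge0 x; lra.
have s0 := divr_gt0 e0 x1; exists ((e / (nrm x + 1)) *: x); first exact: (proj2 D_cone).
rewrite subr0 nrmZ gtr0_norm // mulrAC ltr_pdivrMr // ltr_pM2l //; lra.
Qed.

Let clsD_scale c x : 0 <= c -> cls D x -> cls D (c *: x).
Proof.
rewrite le_eqVlt => /orP[/eqP <-|c0] Dx; first by rewrite scale0r.
exact: cls_scale.
Qed.

Let clsD_sum (I : finType) (c : I -> R) (w : I -> 'cV[R]_n.+1) :
  (forall i, 0 <= c i) -> (forall i, cls D (w i)) -> cls D (\sum_i c i *: w i).
Proof.
move=> c0 Dw; apply: (big_ind (cls D)) => // [x y|i _]; first exact: cls_add.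
exact: clsD_scale.
Qed.

(* A point in the relative interior of [D] satisfies [a x <= t x] for some [t];
   the points of [D] that do so form an invariant cone, so minimality propagates
   the inequality to all of [D]. *)
Lemma minimal_cone_dominated a : A a -> exists2 t : R, 0 < t &
  forall x, cls D x -> cls D (t *: x - a *m x).
Proof.
move=> Aa; have [l [lD _ lspan]] := exists_spanning_subset D.
have [[x1 Dx1] _ _ _ _] := D_inv.
(* Summing a spanning set produces a relatively interior point; [x1] guarantees that it lies in [Om]
   even if the sum is empty. *)
pose x := x1 + \sum_(i < size l) 1 *: l`_i.
have clx : cls D (\sum_(i < size l) 1 *: l`_i).
  by apply: clsD_sum => // i; apply: sub_cls; apply: lD; exact: mem_nth.
have Dx : D x.
  apply: D_cls; last by apply: cls_add => //; exact: sub_cls.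
  by rewrite /x addrC; apply: cls_opn_add => //; [apply: clsS clx|exact: D_Om].
have [t t0 Dt] : exists2 t : R, 0 < t & cls D (t *: x - a *m x).
  have := lspan _ (D_A Aa Dx); move: (a *m x) => y yl.
  rewrite (coord_span (X := in_tuple l) yl).
  pose c (i : 'I_(size l)) := coord (in_tuple l) i y.
  have S0 : 0 <= \sum_i `|c i| by apply: sumr_ge0.
  (* This constant exceeds every coefficient of [a x], so the difference is a nonnegative
     combination. *)
  exists (1 + \sum_i `|c i|); first by lra.
  set t := 1 + _.
  rewrite (_ : _ - _ = t *: x1 + \sum_i (t - c i) *: l`_i); last first.
    rewrite /x scalerDr -addrA; congr (_ + _); rewrite scaler_sumr -sumrB.
    by apply: eq_bigr => i _; rewrite scale1r scalerBl.
  apply: cls_add => //; first by apply: cls_scale; [|rewrite /t; lra|exact: sub_cls].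
  apply: clsD_sum => i; last by apply: sub_cls; apply: lD; exact: mem_nth.
  have : `|c i| <= \sum_i `|c i| by rewrite (bigD1 i) //= lerDl sumr_ge0.
  by have := ler_norm (c i); rewrite /t; lra.
exists t => //; pose E x := D x /\ cls D (t *: x - a *m x).
have opE y : t *: y - a *m y = (t%:M - a) *m y by rewrite mulmxBl mul_scalar_mx.
have Einv : invc E.
  split.
  - by exists x.
  - by move=> y [Dy _]; case: D_inv => _ DC _ _ _; exact: DC.
  - split=> [y z [Dy Ey] [Dz Ez]|c y c0 [Dy Ey]]; split; rewrite ?opE.
    + exact: (proj1 D_cone).
    + by rewrite mulmxDr -!opE; exact: cls_add.
    + exact: (proj2 D_cone).
    + by rewrite -scalemxAr -opE; exact: cls_scale.
  - move=> b y Ab [Dy Ey]; split; first exact: D_A.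
    rewrite mulmxA (A_comm Aa Ab) -mulmxA scalemxAr -mulmxBr; exact: clsD_A.
  - move=> y Oy cly; split; first by apply: D_cls => //; apply: clsS cly => z [].
    by rewrite opE; apply: clsK; apply: cls_lin cly => z [_]; rewrite opE.
have DE := D_min Einv (fun y Ey => proj1 Ey).
by move=> y cly; rewrite opE; apply: clsK; apply: cls_lin cly => z /DE[_]; rewrite opE.
Qed.

(** One point [x0] of [D] is decomposed into independent eigenvectors; minimality then confronts [D]
    with the faces of the simplicial cone they span. *)
Lemma minimal_cone_is_simplex :
  exists (k : nat) (w : 'I_k.+1 -> 'cV[R]_n.+1) (chi : 'M[R]_n.+1 -> 'I_k.+1 -> R),
  [/\ forall c : 'I_k.+1 -> R, \sum_i c i *: w i = 0 -> forall i, c i = 0,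
      forall a i, A a -> 0 < chi a i /\ a *m w i = chi a i *: w i &
      forall x, D x <-> exists2 c : 'I_k.+1 -> R, (forall i, 0 < c i) & x = \sum_i c i *: w i].
Proof.
have [[x0 Dx0] DC _ _ _] := D_inv.
have clsD_gt0 x : cls D x -> x != 0 -> 0 < fv f x.
  by move=> Dx; apply: cls_gt0; apply: clsS Dx.
have [k [w [w_eig x0w w_ind]]] := @independent_eigvec_sum R _ f (cls D) A
  clsD0 clsD_cone (fun x => @clsK _ _ D x) clsD_gt0 clsD_A minimal_cone_dominated x0 (sub_cls Dx0).
case: k => [|k] in w w_eig x0w w_ind *.
  by move: (Om_gt0 (D_Om Dx0)); rewrite x0w big_ord0 /fv mulmx0 mxE ltxx.
have w_ne0 i : w i != 0.
  apply/eqP => wi0; have := w_ind (fun j => (j == i)%:R); rewrite (bigD1 i) //=.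
  rewrite wi0 scaler0 add0r big1 => [|j /negPf ->]; last by rewrite scale0r.
  by move=> /(_ erefl i)/eqP; rewrite eqxx oner_eq0.
have [chi chiP] : exists chi : 'M[R]_n.+1 -> 'I_k.+1 -> R,
    forall a i, A a -> a *m w i = chi a i *: w i.
  have /choice[h hP] (ai : 'M[R]_n.+1 * 'I_k.+1) : exists c, A ai.1 -> ai.1 *m w ai.2 = c *: w ai.2.
    have [Aa|nA] := pselect (A ai.1); last by exists 0.
    by have [c cP] := proj2 (w_eig ai.2) _ Aa; exists c.
  by exists (fun a i => h (a, i)) => a i Aa; exact: (hP (a, i) Aa).
have chi_gt0 a i : A a -> 0 < chi a i.
  move=> Aa; have aw := chiP a i Aa.
  have aw0 : a *m w i != 0.
    apply: contra (w_ne0 i) => /eqP aw0; apply/eqP.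
    by rewrite -(mulKmx (A_unit Aa) (w i)) aw0 mulmx0.
  have Dw := proj1 (w_eig i).
  have := clsD_gt0 _ (clsD_A Aa Dw) aw0; rewrite aw fvZ pmulr_lgt0 //.
  exact: clsD_gt0.
have [phi phiE] := linear_coordinates w_ind.
have comb_cls (c : 'I_k.+1 -> R) : (forall i, 0 <= c i) -> cls D (\sum_i c i *: w i).
  by move=> c0; apply: clsD_sum => // i; case: (w_eig i).
(* The face where the coordinates in [J] vanish, cut down to [Om]. It is an invariant cone inside
   [D], so as soon as it has one point it contains all of [D]. *)
pose F (J : pred 'I_k.+1) x := Om x /\ exists2 c : 'I_k.+1 -> R,
  (forall i, 0 <= c i /\ (J i -> c i = 0)) & x = \sum_i c i *: w i.
have FD J x : F J x -> D x.
  by move=> [Ox [c cP xE]]; apply: D_cls => //; rewrite xE; apply: comb_cls => i; case: (cP i).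
have Finv J x : F J x -> forall y, D y -> F J y.
  move=> Fx; apply: D_min; last exact: FD.
  split; first by exists x.
  - by move=> y /FD/DC.
  - split=> [y z [Oy [c cP yE]] [Oz [d dP zE]]|r y r0 [Oy [c cP yE]]].
      split; first exact: OmD.
      exists (fun i => c i + d i) => [i|]; last first.
        by rewrite yE zE -big_split /=; apply: eq_bigr => i _; rewrite scalerDl.
      have [[c0 cJ] [d0 dJ]] := (cP i, dP i); split; first exact: addr_ge0.
      by move=> Ji; rewrite cJ // dJ // addr0.
    split; first exact: OmZ.
    exists (fun i => r * c i) => [i|]; last first.
      by rewrite yE scaler_sumr; apply: eq_bigr => i _; rewrite scalerA.
    have [c0 cJ] := cP i; split; first by rewrite mulr_ge0 // ltW.
    by move=> /cJ ->; rewrite mulr0.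
  - move=> a y Aa [Oy [c cP yE]]; split; first exact: A_Om.
    exists (fun i => c i * chi a i) => [i|]; last first.
      rewrite yE mulmx_sumr; apply: eq_bigr => i _.
      by rewrite -scalemxAr chiP // scalerA.
    have [c0 cJ] := cP i; split; first by rewrite mulr_ge0 // ltW // chi_gt0.
    by move=> /cJ ->; rewrite mul0r.
  - move=> y Oy cly; split=> //; exists (fun i => fv (phi i) y) => [i|].
      have y0 : 0 <= fv (phi i) y.
        apply: (cls_fv_ge0 _ cly) => z [_ [c cP ->]].
        by rewrite phiE; case: (cP i).
      split=> // Ji; apply/eqP; rewrite eq_le y0 andbT -oppr_ge0.
      have -> : - fv (phi i) y = fv (- phi i) y by rewrite /fv mulNmx [RHS]mxE.
      apply: (cls_fv_ge0 _ cly) => z [_ [c cP ->]].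
      rewrite /fv mulNmx mxE -/(fv _ _) phiE.
      by have [_ /(_ Ji) ->] := cP i; rewrite oppr0.
    (* Lying in the span of the [w i] is expressed as the vanishing of a linear map, a condition
       that survives closure. *)
    have projE z : (1%:M - \sum_i w i *m phi i) *m z = z - \sum_i fv (phi i) z *: w i.
      rewrite mulmxBl mul1mx mulmx_suml; congr (_ - _); apply: eq_bigr => i _.
      by rewrite -mulmxA [phi i *m z]mx11_scalar mul_mx_scalar.
    apply/eqP; rewrite -subr_eq0 -projE; apply/eqP.
    apply: cls_eq0; apply: cls_lin cly => z [_ [c cP ->]].
    by rewrite projE; apply/eqP; rewrite subr_eq0; apply/eqP; apply: eq_bigr => i _; rewrite phiE.
exists k, w, chi; split=> //.
  by move=> a i Aa; split; [exact: chi_gt0|exact: chiP].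
have x0w1 : x0 = \sum_i 1 *: w i by rewrite x0w; apply: eq_bigr => i _; rewrite scale1r.
move=> x; split=> [Dx|[c c0 xE]].
  have F0 : F pred0 x0.
    split; first exact: D_Om.
    by exists (fun=> 1) => // i; rewrite ler01.
  have [_ [c cP xE]] := Finv _ _ F0 _ Dx.
  exists c => // i; rewrite lt_neqAle (proj1 (cP i)) andbT; apply/eqP => ci0.
  (* A vanishing coordinate of [x] would vanish on all of [D], but [x0] has all coordinates equal to
     [1]. *)
  have F1 : F (pred1 i) x.
    split; first exact: D_Om.
    by exists c => // j; split=> [|/eqP ->] //; case: (cP j).
  have [_ [d dP]] := Finv _ _ F1 _ Dx0.
  rewrite x0w1 => /(congr1 (fv (phi i))); rewrite !phiE => /eqP.
  by have [_ -> /=] := dP i; rewrite ?oner_eq0 //=.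
have [e e0 ec] : exists2 e, 0 < e & forall i, e <= c i.
  pose i1 := [arg min_(i < ord0) c i]%O.
  by exists (c i1) => // i; rewrite /i1; case: arg_minP => // j _; apply.
apply: D_cls; last by rewrite xE; apply: comb_cls => i; exact: ltW.
(* Splitting off a small multiple of [x0] leaves a point of the closure; the sum lies in [Om], where
   [D] is closed. *)
rewrite (_ : x = \sum_i (c i - e) *: w i + e *: x0).
  apply: cls_opn_add => //; last by apply: OmZ => //; exact: D_Om.
  by apply: (clsS D_Om); apply: comb_cls => i; rewrite subr_ge0.
rewrite xE x0w scaler_sumr -big_split /=; apply: eq_bigr => i _.
by rewrite scalerBl subrK.
Qed.

End MinimalCone.

(** * The lattice of eigenvalue ratios *)

Section Lattice.
Variables (R : realType) (n k : nat).
Variables (Om D K : 'cV[R]_n.+1 -> Prop) (A : 'M[R]_n.+1 -> Prop).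
Variables (w : 'I_k.+1 -> 'cV[R]_n.+1) (chi : 'M[R]_n.+1 -> 'I_k.+1 -> R).
Hypothesis D_Om : forall x, D x -> Om x.
Hypothesis w_ind : forall c : 'I_k.+1 -> R, \sum_i c i *: w i = 0 -> forall i, c i = 0.
Hypothesis chi_gt0 : forall a i, A a -> 0 < chi a i.
Hypothesis chiP : forall a i, A a -> a *m w i = chi a i *: w i.
Hypothesis DE : forall x, D x <->
  exists2 c : 'I_k.+1 -> R, (forall i, 0 < c i) & x = \sum_i c i *: w i.
Hypothesis A_unit : forall a, A a -> a \in unitmx.
Hypothesis A1 : A 1%:M.
Hypothesis A_mul : forall a b, A a -> A b -> A (a *m b).
Hypothesis A_inv : forall a, A a -> A (invmx a).
Hypothesis A_scale : forall (c : R) a, 0 < c -> A a -> A (c *: a).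
Hypothesis A_comm : forall a b, A a -> A b -> a *m b = b *m a.
Hypothesis K_D : forall x, K x -> D x.
Hypothesis K_cls : forall x, cls K x -> K x.
Hypothesis K_bnd : exists M : R, forall x, K x -> nrm x <= M.
Hypothesis K_cob : forall x, D x -> exists2 a, A a & K (a *m x).
Hypothesis A_key : forall x (c : R), Om x ->
  exists (T : finType) (key : 'M[R]_n.+1 -> T), forall g h,
    A g -> Om (c *: x - g *m x) -> Om (c *: x - invmx g *m x) ->
    A h -> Om (c *: x - h *m x) -> Om (c *: x - invmx h *m x) ->
    key g = key h -> exists s, g = s *: h.

Let w_ne0 i : w i != 0.
Proof.
apply/eqP => wi0; have := @w_ind (fun j => (j == i)%:R); rewrite (bigD1 i) //=.
rewrite wi0 scaler0 add0r big1 => [|j /negPf ->]; last by rewrite scale0r.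
by move=> /(_ erefl i)/eqP; rewrite eqxx oner_eq0.
Qed.

Lemma chi_eq a i c : A a -> a *m w i = c *: w i -> chi a i = c.
Proof.
move=> Aa; rewrite chiP // => /eqP; rewrite -subr_eq0 -scalerBl scaler_eq0.
by rewrite (negPf (w_ne0 i)) orbF subr_eq0 => /eqP.
Qed.

Lemma chiM a b i : A a -> A b -> chi (a *m b) i = chi a i * chi b i.
Proof.
move=> Aa Ab; apply: chi_eq; first exact: A_mul.
by rewrite -mulmxA chiP // -scalemxAr chiP // scalerA mulrC.
Qed.

Lemma chi1 i : chi 1%:M i = 1.
Proof. by apply: chi_eq => //; rewrite mul1mx scale1r. Qed.

Lemma chiZ c a i : 0 < c -> A a -> chi (c *: a) i = c * chi a i.
Proof.
move=> c0 Aa; apply: chi_eq; first exact: A_scale.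
by rewrite -scalemxAl chiP // scalerA.
Qed.

(** Logarithms of the eigenvalue ratios with index [0] as reference; taking ratios makes [lam] blind
    to positive rescaling of [a]. *)
Definition lam (a : 'M[R]_n.+1) : 'rV[R]_k :=
  \row_i (ln (chi a (lift ord0 i)) - ln (chi a ord0)).

Lemma lamM a b : A a -> A b -> lam (a *m b) = lam a + lam b.
Proof.
move=> Aa Ab; apply/matrixP => i j; rewrite !mxE !chiM // !lnM ?posrE ?chi_gt0 //; ring.
Qed.

Lemma lam1 : lam 1%:M = 0.
Proof. by apply/matrixP => i j; rewrite !mxE !chi1 subrr. Qed.

Lemma lamV a : A a -> lam (invmx a) = - lam a.
Proof.
move=> Aa; apply/eqP; rewrite -addr_eq0 -lamM //; last exact: A_inv.
by rewrite mulVmx ?A_unit // lam1.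
Qed.

Lemma lamZ c a : 0 < c -> A a -> lam (c *: a) = lam a.
Proof.
move=> c0 Aa; apply/matrixP => i j; rewrite !mxE !chiZ // !lnM ?posrE ?chi_gt0 //; ring.
Qed.

Lemma A_expz a (z : int) : A a -> A (a ^ z) /\ lam (a ^ z) = lam a *~ z.
Proof.
move=> Aa; have An m : A (a ^+ m) /\ lam (a ^+ m) = lam a *+ m.
  elim: m => [|m [Am lm]]; first by rewrite expr0 mulr0n; split; [exact: A1|exact: lam1].
  by rewrite exprS mulrS; split; [exact: A_mul|rewrite lamM // lm].
case: z => m; first exact: An.
have [Am lm] := An m.+1; rewrite NegzE -exprz_inv mulrNz.
have -> : a^-1 ^ m.+1 = invmx (a ^+ m.+1) by rewrite exprz_inv.
by split; [exact: A_inv|rewrite lamV // lm].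
Qed.

Lemma A_prod (I : finType) (b : I -> 'M[R]_n.+1) (z : I -> int) :
  (forall i, A (b i)) ->
  A (\prod_i b i ^ z i) /\ lam (\prod_i b i ^ z i) = \sum_i lam (b i) *~ z i.
Proof.
move=> Ab; apply: (big_rec2 (fun p q => A p /\ lam p = q)).
  by split; [exact: A1|exact: lam1].
move=> i p q _ [Ap lp]; have [Abi lbi] := A_expz (z i) (Ab i).
by split; [exact: A_mul|rewrite -[_ * p]/(_ *m p) lamM // lbi lp].
Qed.

Lemma A_prodD (I : finType) (b : I -> 'M[R]_n.+1) (y z : I -> int) :
  (forall i, A (b i)) ->
  \prod_i b i ^ (y i + z i) = (\prod_i b i ^ y i) *m (\prod_i b i ^ z i).
Proof.
move=> Ab; pose Q p q r := [/\ A p, A q, A r & r = p *m q].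
suff [] : Q (\prod_i b i ^ y i) (\prod_i b i ^ z i) (\prod_i b i ^ (y i + z i)) by [].
apply: big_rec3 => [|i p q r _ [Ap Aq Ar ->]].
  by split=> //; rewrite ?mulmx1.
have [[Ay _] [Az _]] := (A_expz (y i) (Ab i), A_expz (z i) (Ab i)).
have [Ayz _] := A_expz (y i + z i) (Ab i).
rewrite -!mulmxE; split; [exact: A_mul|exact: A_mul|by do 2![apply: A_mul => //]|].
have E : b i ^ (y i + z i) = b i ^ y i *m b i ^ z i.
  by rewrite exprzDr //; exact: A_unit.
rewrite E -!mulmxA; congr (_ *m _).
by rewrite !mulmxA (A_comm Az Ap).
Qed.

Lemma K_coef_bounded : exists2 B : R, 1 < B &
  forall c : 'I_k.+1 -> R, K (\sum_i c i *: w i) -> forall i, B^-1 < c i < B.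
Proof.
have [phi phiE] := linear_coordinates w_ind.
have [M KM] := K_bnd.
(* Open boxes in coordinates exhausting the simplicial cone; [m.+2] keeps the bound above [1]. *)
pose U (m : nat) x := forall i, (m.+2%:R)^-1 < fv (phi i) x /\ fv (phi i) x < m.+2%:R.
have [m x Ux|x /K_D/DE[c c0 xE]|l Hl] := @heine_borel R _ K M nat U KM K_cls.
- pose N := \sum_i nrm (phi i) + 1.
  have N0 : 0 < N by rewrite ltr_wpDl // sumr_ge0 // => i _; exact: nrm_ge0.
  pose d i := Num.min (fv (phi i) x - (m.+2%:R)^-1) (m.+2%:R - fv (phi i) x).
  have [e e0 ed] : exists2 e : R, 0 < e & forall i, e <= d i.
    pose i1 := [arg min_(i < ord0) d i]%O.
    exists (d i1); last by move=> i; rewrite /i1; case: arg_minP => // j _; apply.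
    by have [h1 h2] := Ux i1; rewrite lt_min !subr_gt0 h1 h2.
  exists (e / N); first exact: divr_gt0.
  move=> y; rewrite ltr_pdivlMr // => yx i.
  have h : `|fv (phi i) y - fv (phi i) x| < e.
    rewrite -fvN -fvD; apply: le_lt_trans (entry_le_nrm _ _ _) _.
    apply: le_lt_trans (nrmM _ _) _; apply: le_lt_trans yx.
    rewrite mulrC ler_wpM2l ?nrm_ge0 // /N (bigD1 i) //= -addrA lerDl addr_ge0 //.
    by apply: sumr_ge0 => j _; exact: nrm_ge0.
  have := ed i; rewrite /d le_min => /andP[h1 h2].
  move: h; rewrite ltr_norml => /andP[h3 h4].
  by move: ((m.+2%:R : R)^-1) (m.+2%:R : R) h1 h2 => p q h1 h2; split; lra.
- have fx i : fv (phi i) x = c i by rewrite xE phiE.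
  have [t [t0 tP]] : exists t : R, 0 < t /\ forall i, c i <= t /\ (c i)^-1 <= t.
    exists (1 + \sum_i (c i + (c i)^-1)).
    have P i : 0 < c i + (c i)^-1 by rewrite addr_gt0 // invr_gt0.
    have S0 : 0 <= \sum_i (c i + (c i)^-1) by apply: sumr_ge0 => i _; exact: ltW.
    split=> [|i]; first by lra.
    have : c i + (c i)^-1 <= \sum_i (c i + (c i)^-1).
      by rewrite [leRHS](bigD1 i) //= lerDl sumr_ge0 // => j _; exact: ltW.
    have := c0 i; have : 0 < (c i)^-1 by rewrite invr_gt0.
    by split; lra.
  have tm : t < (Num.truncn t).+2%:R.
    have /andP[_] := truncn_itv (ltW t0).
    by move/lt_trans; apply; rewrite ltr_nat.
  exists (Num.truncn t) => i; rewrite fx; have [h1 h2] := tP i.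
  split; last exact: le_lt_trans tm.
  by rewrite invf_plt ?posrE //; exact: le_lt_trans tm.
exists (\sum_(m <- l) m.+2%:R + 2).
  by apply: (@lt_le_trans _ _ 2); [lra|rewrite lerDr; apply: sumr_ge0].
move=> c /Hl[m lm Um] i; have [h1 h2] := Um i; rewrite phiE in h1 h2.
have hm : m.+2%:R <= \sum_(m <- l) m.+2%:R + 2 :> R.
  elim: l lm {Hl} => [//|m' l IHl] [->|/IHl h]; rewrite big_cons.
    by rewrite -addrA lerDl addr_ge0 // sumr_ge0.
  by rewrite -addrA ler_wpDl.
rewrite (lt_le_trans h2 hm) andbT; apply: le_lt_trans h1.
by rewrite lef_pV2 // posrE //; apply: lt_le_trans hm.
Qed.

(** The point with coordinates [1] and [exp (- z j)] is brought into [K] by some [a]. The new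
    coordinates lie between [1 / B] and [B], so [lam a] differs from [z] by at most [2 ln B] in each
    entry. *)
Lemma lam_cobounded : exists B : R, forall z : 'rV[R]_k,
  exists2 a, A a & forall i, `|lam a 0 i - z 0 i| <= B.
Proof.
have [B B1 HB] := K_coef_bounded; have B0 : 0 < B by lra.
exists (ln B + ln B) => z.
pose c (i : 'I_k.+1) := if unlift ord0 i is Some j then expR (- z 0 j) else 1.
have c0 i : 0 < c i by rewrite /c; case: unlift => // j; exact: expR_gt0.
have Dx : D (\sum_i c i *: w i) by apply/DE; exists c.
have [a Aa Ka] := K_cob Dx; exists a => // j.
have := HB (fun i => c i * chi a i).
have -> : \sum_i (c i * chi a i) *: w i = a *m (\sum_i c i *: w i).
  by rewrite mulmx_sumr; apply: eq_bigr => i _; rewrite -scalemxAr chiP // scalerA.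
move=> /(_ Ka) Hc.
have lnb (y : R) : B^-1 < y -> y < B -> - ln B < ln y < ln B.
  move=> h1 h2; have y0 : 0 < y by apply: lt_trans h1; rewrite invr_gt0.
  by rewrite -lnV ?posrE // !ltr_ln ?posrE ?invr_gt0 // h1 h2.
have /andP[/lnb h1 /h1] := Hc ord0.
have /andP[/lnb h3 /h3] := Hc (lift ord0 j).
rewrite /c unlift_none mul1r liftK lnM ?posrE ?expR_gt0 ?chi_gt0 // expRK.
move=> /andP[g1 g2] /andP[g3 g4].
by rewrite mxE ler_norml; apply/andP; split; lra.
Qed.

(** If the values of [lam] did not span, some [v] would be orthogonal to them all, and far multiples
    of [v] would violate [lam_cobounded]. *)
Lemma lam_basis : exists b : 'I_k -> 'M[R]_n.+1,
  [/\ forall i, A (b i),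
      forall c : 'I_k -> R, \sum_i c i *: lam (b i) = 0 -> forall i, c i = 0 &
      forall a, A a -> exists c : 'I_k -> R, lam a = \sum_i c i *: lam (b i)].
Proof.
have [l [lA lfree lspan]] := exists_spanning_subset (fun z => exists2 a, A a & z = lam a).
have sl : size l = k.
  apply/eqP; rewrite eqn_leq; apply/andP; split.
    have /eqP <- := lfree; rewrite (leq_trans (dimvS (subvf _))) //.
    by rewrite dimvf /= /dim /= mul1n.
  rewrite leqNgt; apply/negP => slk.
  pose X := \matrix_(i < size l, j < k) l`_i 0 j.
  have : kermx X^T != 0.
    rewrite -mxrank_eq0 mxrank_ker mxrank_tr -lt0n subn_gt0.
    exact: leq_ltn_trans (rank_leq_row _) slk.
  move=> /rowV0Pn[v /sub_kermxP vX v0].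
  have lv z : z \in <<l>>%VS -> \sum_j v 0 j * z 0 j = 0.
    move=> zl; rewrite (coord_span (X := in_tuple l) zl).
    under eq_bigr do rewrite summxE mulr_sumr.
    rewrite exchange_big big1 //= => i _.
    have vXi : \sum_j v 0 j * l`_i 0 j = 0.
      move/matrixP: vX => /(_ 0 i); rewrite !mxE => vXi; apply: etrans vXi.
      by apply: eq_bigr => j _; rewrite !mxE.
    transitivity (coord (in_tuple l) i z * \sum_j v 0 j * l`_i 0 j); last by rewrite vXi mulr0.
    by rewrite mulr_sumr; apply: eq_bigr => j _; rewrite !mxE mulrCA.
  have [B HB] := lam_cobounded.
  pose q := \sum_j v 0 j * v 0 j.
  have q0 : 0 < q.
    rewrite lt_neqAle sumr_ge0 ?andbT => [|j _]; last by rewrite -expr2 sqr_ge0.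
    apply: contra v0 => q0; apply/eqP/matrixP => i j; rewrite ord1 mxE.
    have /eqP : \sum_j v 0 j * v 0 j = 0 by apply/eqP; rewrite eq_sym.
    rewrite psumr_eq0 => [|j' _]; last by rewrite -expr2 sqr_ge0.
    by move=> /allP/(_ j (mem_index_enum _)); rewrite /= mulf_eq0 orbb => /eqP.
  pose S := \sum_j `|v 0 j|.
  (* The multiple is chosen so that pairing with [v] gives exactly [B * S + 1], while closeness to
     [lam a] allows at most [B * S]. *)
  have [a Aa Ha] := HB (((B * S + 1) / q) *: v).
  have : `|\sum_j v 0 j * (lam a 0 j - (((B * S + 1) / q) *: v) 0 j)| <= B * S.
    apply: le_trans (ler_norm_sum _ _ _) _; rewrite [leRHS]mulrC mulr_suml.
    by apply: ler_sum => j _; rewrite normrM ler_wpM2l.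
  under eq_bigr do rewrite mulrBr.
  rewrite sumrB lv; last by apply: lspan; exists a.
  under eq_bigr do rewrite mxE mulrCA.
  rewrite -mulr_sumr -/q divfK ?gt_eqF // sub0r normrN.
  by move=> h; have := le_trans (ler_norm _) h; lra.
have /choice[b bP] (i : 'I_k) : exists a, A a /\ l`_i = lam a.
  by have [|a Aa la] := lA l`_i; [apply: mem_nth; rewrite sl|exists a].
exists b; split=> [i|c c0|a Aa].
- by case: (bP i).
- move: lfree; rewrite (_ : l = in_tuple l) // => /freeP lfree i.
  have := lfree (fun j => c (cast_ord sl j)); rewrite (reindex (cast_ord (esym sl))) /=; last first.
    by exists (cast_ord sl) => j _; rewrite ?cast_ordKV ?cast_ordK.
  move=> /(_ _ (cast_ord (esym sl) i)); rewrite cast_ordKV; apply.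
  apply: etrans c0; apply: eq_bigr => j _; rewrite cast_ordKV; congr (_ *: _).
  by have [_ <-] := bP j.
have la : lam a \in <<l>>%VS by apply: lspan; exists a.
exists (fun i => coord (in_tuple l) (cast_ord (esym sl) i) (lam a)).
rewrite {1}(coord_span (X := in_tuple l) la) (reindex (cast_ord (esym sl))) /=.
  by apply: eq_bigr => i _; have [_ <-] := bP i.
by exists (cast_ord sl) => j _; rewrite ?cast_ordKV ?cast_ordK.
Qed.

(** Independence of the [lam (b i)] gives injectivity. Rounding down the coordinates of [lam a]
    leaves a remainder with bounded eigenvalue ratios, and proper discontinuity allows only finitely
    many of these up to scalars. *)
Lemma lattice_of_finite_index : exists b : 'I_k -> 'M[R]_n.+1,
  [/\ forall i, A (b i),
      forall (y z : 'I_k -> int) (s : R),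
        \prod_i b i ^ y i = s *: \prod_i b i ^ z i -> forall i, y i = z i &
      exists2 l : seq 'M[R]_n.+1, forall h, h \in l -> A h &
        forall a, A a -> exists h (z : 'I_k -> int) (s : R),
          h \in l /\ a = s *: (h *m \prod_i b i ^ z i)].
Proof.
have [b [Ab b_ind b_span]] := lam_basis; exists b; split=> //.
  move=> y z s E i.
  have [[Ay ly] [Az lz]] := (A_prod y Ab, A_prod z Ab).
  have Dx0 : D (\sum_i 1 *: w i) by apply/DE; exists (fun=> 1).
  have s0 : 0 < s.
    have := chi_gt0 ord0 Ay; rewrite (_ : chi _ _ = s * chi (\prod_i b i ^ z i) ord0).
      by rewrite pmulr_lgt0 // chi_gt0.
    by apply: chi_eq => //; rewrite E -scalemxAl chiP // scalerA.
  have : lam (\prod_i b i ^ y i) = lam (\prod_i b i ^ z i) by rewrite E lamZ.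
  rewrite ly lz => /eqP; rewrite -subr_eq0 -sumrB => /eqP yz.
  have := b_ind (fun i => (y i - z i)%:~R) _ i; move=> /(_ _)/eqP.
  rewrite intr_eq0 subr_eq0 => H; apply/eqP/H; apply: etrans yz; apply: eq_bigr => j _.
  by rewrite scaler_int mulrzBr.
pose B := \sum_i nrm (lam (b i)).
pose x0 := \sum_i 1 *: w i.
have Dx0 : D x0 by apply/DE; exists (fun=> 1).
(* [B] bounds [lam] on the fundamental cell; the added [1] makes the coordinates of [t x0 - a x0]
   strictly positive. *)
pose t := expR B + 1.
have [T [key Hkey]] := A_key t (D_Om Dx0).
pose P a := [/\ A a, Om (t *: x0 - a *m x0) & Om (t *: x0 - invmx a *m x0)].
have [l lP Hl] := fiber_representatives key P.
exists l => [h /lP[]//|a Aa].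
have [c ca] := b_span a Aa; pose z i := Num.floor (c i).
have [Az lz] := A_prod z Ab; set p := \prod_i b i ^ z i in Az lz.
pose a' := a *m invmx p; have Aa' : A a' by apply: A_mul => //; exact: A_inv.
have la' j : `|lam a' 0 j| <= B.
  have -> : lam a' = \sum_i (c i - (z i)%:~R) *: lam (b i).
    rewrite lamM ?lamV //; last exact: A_inv.
    rewrite ca lz -sumrB; apply: eq_bigr => i _.
    by rewrite scalerBl scaler_int.
  rewrite summxE; apply: le_trans (ler_norm_sum _ _ _) _; apply: ler_sum => i _.
  rewrite mxE normrM -[leRHS]mul1r; apply: ler_pM => //; last exact: entry_le_nrm.
  have /andP[f1 f2] := mem_rg1_floor (c i).
  by rewrite ler_norml; apply/andP; split; lra.
pose r := chi a' ord0; have r0 : 0 < r by exact: chi_gt0.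
(* Normalizing the eigenvalue at index [0] to [1] turns bounds on ratios into bounds on
   eigenvalues. *)
pose a2 := r^-1 *: a'; have Aa2 : A a2 by apply: A_scale; rewrite ?invr_gt0.
have chi2 i : expR (- B) <= chi a2 i <= expR B.
  have B0 : 0 <= B by apply: sumr_ge0 => j _; exact: nrm_ge0.
  have c20 : chi a2 ord0 = 1 by rewrite chiZ ?invr_gt0 // mulVf // gt_eqF.
  case: (unliftP ord0 i) => [j ->|->]; last first.
    by rewrite c20 -{1 2}expR0 !ler_expR oppr_le0 B0.
  have := la' j; rewrite -(@lamZ r^-1) ?invr_gt0 // -/a2 mxE c20 ln1 subr0.
  rewrite ler_norml => /andP[h1 h2]; have := chi_gt0 (lift ord0 j) Aa2.
  by move: h1 h2; move: (chi a2 _) => x h1 h2 xp; rewrite -[x]lnK ?posrE // !ler_expR h1.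
have bnd g : A g -> (forall i, chi g i <= expR B) -> Om (t *: x0 - g *m x0).
  move=> Ag gB; apply: D_Om; apply/DE; exists (fun i => t - chi g i) => [i|].
    by have := gB i; rewrite /t; lra.
  rewrite /x0 scaler_sumr mulmx_sumr -sumrB; apply: eq_bigr => i _.
  by rewrite !scale1r chiP // scalerBl.
have Pa2 : P a2.
  split=> //; first by apply: bnd => // i; case/andP: (chi2 i).
  apply: bnd; first exact: A_inv.
  move=> i; have Ai := A_inv Aa2; have /andP[h _] := chi2 i.
  have E : chi (invmx a2) i * chi a2 i = 1 by rewrite -chiM // mulVmx ?A_unit // chi1.
  have c2 := chi_gt0 i Aa2.
  have -> : chi (invmx a2) i = (chi a2 i)^-1 by rewrite -[LHS](mulfK (lt0r_neq0 c2)) E mul1r.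
  by rewrite -[expR B]invrK -expRN lef_pV2 // posrE ?expR_gt0.
have [h hl hk] := Hl _ Pa2; have [Ah h1 h2] := lP _ hl; have [_ a1 a2'] := Pa2.
have [s Es] := Hkey _ _ Aa2 a1 a2' Ah h1 h2 (esym hk).
exists h, z, (r * s); split=> //.
have -> : a = r *: (a2 *m p).
  by rewrite /a2 -scalemxAl scalerA divff ?gt_eqF // scale1r mulmxKV // A_unit.
by rewrite Es -scalemxAl scalerA.
Qed.

End Lattice.

(** * Projective distance *)

Section ProjectiveDistance.
Variables (R : realType) (p q : nat).
Implicit Types X Y Z : 'M[R]_(p, q).

(** One definition for both [vnorm], on columns, and [mnorm], on square matrices. *)
Definition eucl X : R := Num.sqrt (\sum_i \sum_j X i j ^+ 2).

Let sum_ge0 X : 0 <= \sum_i \sum_j X i j ^+ 2.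
Proof. by apply: sumr_ge0 => i _; apply: sumr_ge0 => j _; exact: sqr_ge0. Qed.

Let eucl_ge0 X : 0 <= eucl X. Proof. exact: sqrtr_ge0. Qed.

Let eucl_sqr X : eucl X ^+ 2 = \sum_i \sum_j X i j ^+ 2.
Proof. exact: sqr_sqrtr (sum_ge0 X). Qed.

Lemma entry_le_eucl X i j : `|X i j| <= eucl X.
Proof.
rewrite -(ler_pXn2r (ltn0Sn 1)) ?nnegrE // eucl_sqr real_normK ?num_real //.
rewrite (bigD1 i) //= (bigD1 j) //= -addrA lerDl addr_ge0 //.
  by apply: sumr_ge0 => *; exact: sqr_ge0.
by apply: sumr_ge0 => *; apply: sumr_ge0 => *; exact: sqr_ge0.
Qed.

Lemma euclZ c X : eucl (c *: X) = `|c| * eucl X.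
Proof.
rewrite /eucl -sqrtr_sqr -sqrtrM ?sqr_ge0 //; congr Num.sqrt.
rewrite mulr_sumr; apply: eq_bigr => i _; rewrite mulr_sumr; apply: eq_bigr => j _.
by rewrite mxE exprMn.
Qed.

Lemma nrm_le_eucl X : nrm X <= (p * q)%:R * eucl X.
Proof. by apply: nrm_le_entry => i j; exact: entry_le_eucl. Qed.

Lemma eucl_gt0 X : X != 0 -> 0 < eucl X.
Proof.
move=> X0; rewrite lt_neqAle eucl_ge0 andbT; apply: contra X0 => /eqP e0.
apply/eqP/matrixP => i j; rewrite mxE; apply/eqP.
by rewrite -normr_le0 e0; exact: entry_le_eucl.
Qed.

(** A mixed triangle inequality: with [nrm Z] on the right, the cross term needs only the bound of
    each entry of [X] by [eucl X]. *)
Lemma eucl_add_le X Z : eucl (X + Z) <= eucl X + nrm Z.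
Proof.
have Z0 := nrm_ge0 Z; have X0 := eucl_ge0 X.
rewrite -(ler_pXn2r (ltn0Sn 1)) ?nnegrE ?addr_ge0 // eucl_sqr sqrrD eucl_sqr.
have h1 : \sum_i \sum_j X i j * Z i j <= eucl X * nrm Z.
  rewrite /nrm mulr_sumr; apply: ler_sum => i _; rewrite mulr_sumr; apply: ler_sum => j _.
  apply: le_trans (ler_norm _) _; rewrite normrM ler_wpM2r //; exact: entry_le_eucl.
have h2 : \sum_i \sum_j Z i j ^+ 2 <= nrm Z ^+ 2.
  rewrite expr2 [in leRHS]/nrm mulr_suml; apply: ler_sum => i _.
  rewrite mulr_suml; apply: ler_sum => j _.
  rewrite -real_normK ?num_real // expr2 ler_wpM2l //; exact: entry_le_nrm.
have -> : \sum_i \sum_j (X + Z) i j ^+ 2 =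
    \sum_i \sum_j X i j ^+ 2 + (\sum_i \sum_j X i j * Z i j) *+ 2 + \sum_i \sum_j Z i j ^+ 2.
  rewrite -sumrMnl -!big_split /=; apply: eq_bigr => i _.
  rewrite -sumrMnl -!big_split /=; apply: eq_bigr => j _.
  by rewrite mxE sqrrD.
by rewrite !mulr2n; lra.
Qed.

Lemma eucl_le_nrm X : eucl X <= nrm X.
Proof.
have := eucl_add_le 0 X; rewrite add0r (_ : eucl 0 = 0) ?add0r //.
by rewrite /eucl big1 ?sqrtr0 // => i _; rewrite big1 // => j _; rewrite mxE expr0n.
Qed.

Definition edist X Y : R :=
  Num.min (eucl ((eucl X)^-1 *: X - (eucl Y)^-1 *: Y))
          (eucl ((eucl X)^-1 *: X + (eucl Y)^-1 *: Y)).

Lemma edist_near X (e : R) : X != 0 -> 0 < e ->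
  exists2 d : R, 0 < d & forall Y, nrm (Y - X) < d -> Y != 0 /\ edist X Y < e.
Proof.
move=> X0 e0; have x0 := eucl_gt0 X0; pose N := (p * q)%:R + 1 : R.
have N0 : 0 < N by rewrite ltr_wpDl.
(* The first bound keeps [Y] nonzero. The second pays for two terms, the change of vector and the
   change of normalization, of total weight [p * q + 1]. *)
exists (Num.min (eucl X) (e * eucl X / N)).
  by rewrite lt_min x0 divr_gt0 // mulr_gt0.
move=> Y; rewrite lt_min => /andP[YX1 YX2].
have Y0 : Y != 0.
  apply: contraTneq YX1 => ->; rewrite sub0r nrmN -leNgt; exact: eucl_le_nrm.
have y0 := eucl_gt0 Y0; split=> //.
rewrite /edist gt_min; apply/orP; left; apply: le_lt_trans (eucl_le_nrm _) _.
rewrite (_ : _ - _ = (eucl X)^-1 *: (X - Y) + ((eucl X)^-1 - (eucl Y)^-1) *: Y); last first.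
  by mx_ring.
apply: le_lt_trans (nrmD _ _) _; rewrite !nrmZ.
have h1 : `|(eucl X)^-1 - (eucl Y)^-1| * nrm Y <= (p * q)%:R * (nrm (Y - X) / eucl X).
  have -> : (eucl X)^-1 - (eucl Y)^-1 = (eucl Y - eucl X) / (eucl X * eucl Y).
    by field; rewrite !gt_eqF.
  rewrite normrM normfV [`|_ * eucl Y|]gtr0_norm ?mulr_gt0 //.
  have h2 : `|eucl Y - eucl X| <= nrm (Y - X).
    rewrite ler_norml; apply/andP; split.
      have := eucl_add_le Y (X - Y); rewrite addrC subrK nrmBC; lra.
    by have := eucl_add_le X (Y - X); rewrite addrC subrK; lra.
  rewrite invfM [leLHS](_ : _ = `|eucl Y - eucl X| / eucl X * (nrm Y / eucl Y)); last by ring.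
  rewrite [leRHS]mulrC.
  apply: ler_pM; rewrite ?mulr_ge0 ?invr_ge0 ?nrm_ge0 ?(ltW x0) ?(ltW y0) //.
    by rewrite ler_wpM2r // invr_ge0 ltW.
  by rewrite ler_pdivrMr // nrm_le_eucl.
rewrite [X in X + _](_ : _ = nrm (Y - X) / eucl X); last first.
  by rewrite normfV gtr0_norm // nrmBC mulrC.
move: YX2; rewrite ltr_pdivlMr // => YX2.
apply: (@le_lt_trans _ _ (nrm (Y - X) * N / eucl X)); last by rewrite ltr_pdivrMr.
rewrite /N mulrDr mulr1 mulrDl addrC lerD2r (le_trans h1) //.
by rewrite mulrA mulrC [nrm _ * _]mulrC mulrC.
Qed.

(** Converse to [edist_near]: close lines have close representatives, and the branch of the minimum
    decides the sign of [s]. *)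
Lemma edist_approx X (e : R) : X != 0 -> 0 < e ->
  exists2 d : R, 0 < d & forall Y, Y != 0 -> edist X Y < d ->
    exists2 s : R, s != 0 & nrm (s *: Y - X) < e.
Proof.
move=> X0 e0; have x0 := eucl_gt0 X0; pose N := (p * q)%:R + 1 : R.
have N0 : 0 < N by rewrite ltr_wpDl.
exists (e / (eucl X * N)); first by rewrite divr_gt0 // mulr_gt0.
move=> Y Y0; have y0 := eucl_gt0 Y0.
have approx (s : R) : eucl ((eucl X)^-1 *: X - (s / eucl Y) *: Y) < e / (eucl X * N) ->
    nrm ((eucl X * s / eucl Y) *: Y - X) < e.
  rewrite ltr_pdivlMr ?mulr_gt0 // => h; rewrite nrmBC.
  rewrite (_ : _ - _ = eucl X *: ((eucl X)^-1 *: X - (s / eucl Y) *: Y)); last first.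
    by rewrite scalerBr !scalerA mulfV ?gt_eqF // scale1r mulrA.
  rewrite nrmZ gtr0_norm //; apply: le_lt_trans h; rewrite [leRHS]mulrCA ler_pM2l //.
  apply: le_trans (nrm_le_eucl _) _; rewrite [leRHS]mulrC.
  by rewrite ler_wpM2r // lerDl.
rewrite /edist gt_min => /orP[h|h].
  exists (eucl X * 1 / eucl Y); last by apply: approx; rewrite div1r.
  by rewrite mulr1 mulf_neq0 ?invr_eq0 // gt_eqF.
exists (eucl X * -1 / eucl Y); last by apply: approx; rewrite mulN1r scaleNr opprK.
by rewrite mulrN1 mulNr oppr_eq0 mulf_neq0 ?invr_eq0 // gt_eqF.
Qed.

Lemma edist_scale X (c : R) : X != 0 -> c != 0 -> edist X (c *: X) = 0.
Proof.
move=> X0 c0; have x0 := eucl_gt0 X0.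
have e0 : eucl 0 = 0 by apply/eqP; rewrite eq_le eucl_ge0 andbT -(@nrm0 R p q) eucl_le_nrm.
rewrite /edist euclZ scalerA.
have -> : (`|c| * eucl X)^-1 * c = (c / `|c|) * (eucl X)^-1 by rewrite invfM mulrC mulrA.
have [cp|cn|c0'] := ltgtP 0 c; last by rewrite -c0' eqxx in c0.
  rewrite gtr0_norm // divff // mul1r subrr e0; apply/min_idPl; exact: eucl_ge0.
rewrite ltr0_norm // invrN mulrN divff // mulN1r !scaleNr subrr e0.
apply/min_idPr; exact: eucl_ge0.
Qed.

End ProjectiveDistance.

(** * The statement for cones *)

Section ConeFlatTorus.
Variables (R : realType) (n : nat) (f : 'rV[R]_n.+1) (Mb : R).
Variables (Om C : 'cV[R]_n.+1 -> Prop) (L A : 'M[R]_n.+1 -> Prop).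
Hypothesis Om_cone : cone Om.
Hypothesis Om_opn : opn Om.
Hypothesis Om_gt0 : forall x, Om x -> 0 < fv f x.
Hypothesis Mb_ge0 : 0 <= Mb.
Hypothesis Om_bnd : forall x, Om x -> nrm x <= Mb * fv f x.
Hypothesis L_unit : forall g, L g -> g \in unitmx.
Hypothesis L_mul : forall g h, L g -> L h -> L (g *m h).
Hypothesis L_inv : forall g, L g -> L (invmx g).
Hypothesis L_Om : forall g x, L g -> Om x -> Om (g *m x).
Hypothesis L_discrete : exists2 e : R, 0 < e &
  forall g, L g -> nrm (g - 1%:M) < e -> exists c : R, g = c%:M.
Hypothesis C_Om : forall x, C x -> Om x.
Hypothesis C_cone : cone C.
Hypothesis C_cls : forall x, Om x -> cls C x -> C x.
Hypothesis C_ex : exists x, C x.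
Hypothesis L_C : forall g x, L g -> C x -> C (g *m x).
Variable u : 'cV[R]_n.+1.
Hypothesis Om_u : Om u.
Hypothesis L_cobounded : exists c : R, forall x, C x ->
  exists g, [/\ L g, Om (c *: u - g *m x) & Om (c *: (g *m x) - u)].
Hypothesis A_L : forall a, A a -> L a.
Hypothesis A1 : A 1%:M.
Hypothesis A_mul : forall a b, A a -> A b -> A (a *m b).
Hypothesis A_inv : forall a, A a -> A (invmx a).
Hypothesis A_scale : forall (c : R) a, 0 < c -> A a -> A (c *: a).
Hypothesis A_comm : forall a b, A a -> A b -> a *m b = b *m a.
Hypothesis A_max : forall b, L b -> (forall a, A a -> b *m a = a *m b) -> A b.

Theorem cone_flat_torus : exists (k : nat) (w : 'I_k.+1 -> 'cV[R]_n.+1),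
  let S x := exists2 c : 'I_k.+1 -> R, (forall i, 0 < c i) & x = \sum_i c i *: w i in
  [/\ forall c : 'I_k.+1 -> R, \sum_i c i *: w i = 0 -> forall i, c i = 0,
      forall x, S x -> C x,
      forall x, Om x -> cls S x -> S x &
      forall a i, A a -> exists2 c : R, 0 < c & a *m w i = c *: w i] /\
  (exists K : 'cV[R]_n.+1 -> Prop,
    [/\ forall x, K x -> S x, forall x, cls K x -> K x,
        exists M : R, forall x, K x -> nrm x <= M &
        forall x, S x -> exists2 a, A a & K (a *m x)]) /\
  exists b : 'I_k -> 'M[R]_n.+1,
  [/\ forall i, A (b i),
      forall y z : 'I_k -> int,
        \prod_i b i ^ (y i + z i) = (\prod_i b i ^ y i) *m (\prod_i b i ^ z i),
      forall z : 'I_k -> int, A (\prod_i b i ^ z i),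
      forall (y z : 'I_k -> int) (s : R),
        \prod_i b i ^ y i = s *: \prod_i b i ^ z i -> forall i, y i = z i &
      exists2 l : seq 'M[R]_n.+1, forall h, h \in l -> A h &
        forall a, A a -> exists h (z : 'I_k -> int) (s : R),
          h \in l /\ a = s *: (h *m \prod_i b i ^ z i)].
Proof.
have A_unit a : A a -> a \in unitmx by move=> /A_L/L_unit.
have A_Om a x : A a -> Om x -> Om (a *m x) by move=> /A_L; exact: L_Om.
have [D0 D0_inv [c0 c0_gt0 D0_cob]] := exists_cobounded_invariant_cone Om_cone Om_opn
  Om_gt0 Mb_ge0 Om_bnd L_unit L_mul L_inv L_Om L_discrete C_Om C_cone C_cls C_ex L_C
  Om_u L_cobounded A_L A_comm A_max.
have [D [D_inv DD0 D_min]] := exists_minimal_cone Om_cone Om_opn Om_gt0 Mb_ge0 Om_bnd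
  c0_gt0 Om_u D0_inv D0_cob.
have [k [w [chi [w_ind chiP DE]]]] := minimal_cone_is_simplex Om_cone Om_opn Om_gt0 Mb_ge0 Om_bnd
  C_Om A_unit A_Om A_comm D_inv D_min.
have [K [KO Kcl [M KM]] Kbox] := order_box_compact Om_cone Om_opn Om_gt0 Mb_ge0 Om_bnd c0_gt0 Om_u.
have [_ DC D_cone D_A D_cls] := D_inv.
have D_Om x : D x -> Om x by move=> /DC/C_Om.
(* [K] lies in [Om] and [D] is closed in [Om], so the intersection is closed in the whole space. *)
pose KD x := K x /\ D x.
have KD_cls x : cls KD x -> KD x.
  move=> clx; have Kx : K x by apply: Kcl; apply: clsS clx => y [].
  by split=> //; apply: D_cls; [exact: KO|apply: clsS clx => y []].
have KD_cob x : D x -> exists2 a, A a & KD (a *m x).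
  move=> Dx; have [a [Aa a1 a2]] := D0_cob _ (DD0 _ Dx).
  by exists a => //; split; [exact: Kbox|exact: D_A].
have A_key x (c : R) : Om x -> exists (T : finType) (key : 'M[R]_n.+1 -> T), forall g h,
    A g -> Om (c *: x - g *m x) -> Om (c *: x - invmx g *m x) ->
    A h -> Om (c *: x - h *m x) -> Om (c *: x - invmx h *m x) ->
    key g = key h -> exists s, g = s *: h.
  move=> Ox; have [T [key H]] := ordbnd_finite_key Om_cone Om_opn Om_gt0 Mb_ge0 Om_bnd
    L_unit L_mul L_inv L_Om L_discrete c Ox.
  by exists T, key => g h /A_L ? ? ? /A_L ? ? ?; apply: H.
have chi_gt0 a i (Aa : A a) := proj1 (chiP a i Aa).
have chi_eig a i (Aa : A a) := proj2 (chiP a i Aa).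
have [b [Ab bind bfin]] := @lattice_of_finite_index R n k Om D KD A w chi D_Om w_ind
  chi_gt0 chi_eig DE A_unit A1 A_mul A_inv A_scale (fun x => @proj2 _ _) KD_cls
  (ex_intro _ M (fun x h => KM x (proj1 h))) KD_cob A_key.
exists k, w; split; [split=> //|split].
- by move=> x /DE/DC.
- by move=> x Ox clx; apply/DE; apply: D_cls => //; apply: clsS clx => y /DE.
- by move=> a i Aa; exists (chi a i); [exact: chi_gt0|exact: chi_eig].
- exists KD; split=> // [x [_ /DE]//||x /DE/KD_cob//].
  by exists M => x [/KM].
exists b; split=> //.
- by move=> y z; apply: (@A_prodD R n k A w chi).
- by move=> z; have [] := A_prod (chi := chi) (w := w)
    w_ind chi_gt0 chi_eig A_unit A1 A_mul A_inv z Ab.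
Qed.

End ConeFlatTorus.

(** * Linear algebra and convexity in affine charts *)

(** Gaussian elimination writes [W] as an invertible [k] by [k] factor, a partial identity and an
    invertible factor on the right; [N] undoes both invertible ones. *)
Lemma row_free_normal_form (F : fieldType) (k m : nat) (W : 'M[F]_(k, m)) :
  row_free W -> exists2 N : 'M[F]_m, N \in unitmx &
    forall i j, (W *m N) i j = (j == i :> nat)%:R.
Proof.
move=> Wf; have km : (k <= m)%N by move/eqP: (Wf) => {1}<-; rewrite rank_leq_col.
have Em := subnKC km; move: (m - k)%N Em => e Em; subst m.
have /eqP rW := Wf; have := mulmx_ebase W; rewrite rW => EW.
pose Q : 'M[F]_(k + e) := block_mx (invmx (col_ebase W)) 0 0 1%:M.
have Lu := col_ebase_unit W; have Ru := row_ebase_unit W.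
exists (invmx (row_ebase W) *m Q).
  rewrite unitmx_mul unitmx_inv Ru unitmxE det_ublock det1 mulr1 -unitmxE unitmx_inv.
  exact: Lu.
move=> i j; rewrite -[W in W *m _]EW mulmxA mulmxK // pid_mx_row -mulmxA /Q mul_row_block.
rewrite !mul1mx !mul0mx !addr0 mul_mx_row mulmxV // mulmx0.
rewrite mxE; case: splitP => l El; rewrite !mxE El; first by rewrite eq_sym.
by rewrite gtn_eqF // ltn_addr.
Qed.

Lemma extend_to_basis (F : fieldType) (k m : nat) (w : 'I_k -> 'cV[F]_m) :
  (forall c : 'I_k -> F, \sum_i c i *: w i = 0 -> forall i, c i = 0) ->
  (k <= m)%N /\ exists2 G : 'M[F]_m, G \in unitmx &
    forall i, G *m w i = \col_(j < m) (j == i :> nat)%:R.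
Proof.
move=> w_ind; have Wf := row_free_of_independent w_ind.
split; first by move/eqP: (Wf) => {1}<-; rewrite rank_leq_col.
have [N Nu NE] := row_free_normal_form Wf; exists N^T; first by rewrite unitmx_tr.
move=> i; apply/matrixP => j l; rewrite [RHS]mxE -NE.
rewrite [LHS]mxE [RHS]mxE; apply: eq_bigr => r _.
by rewrite !mxE ord1 mulrC.
Qed.

(** With this [t] the chart combination of [x / a] and [y / b] is [(x + y) / (a + b)], a multiple of
    the sum. *)
Lemma convex_parameter (F : realFieldType) (a b : F) : 0 < a * b ->
  exists t, [/\ 0 <= t <= 1, a + b != 0, (1 - t) / a = (a + b)^-1 & t / b = (a + b)^-1].
Proof.
move=> ab.
have [a0 b0] : a != 0 /\ b != 0.
  by apply/andP; rewrite -negb_or -mulf_eq0 gt_eqF.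
have s0 : a + b != 0.
  apply/eqP => h; have E : b = - a by lra.
  by move: ab; rewrite E mulrN oppr_gt0 -expr2 ltNge sqr_ge0.
exists (b / (a + b)); split=> //; last first.
- by rewrite mulrAC divff // mul1r.
- by field; rewrite s0.
have [ap|an|ae] := ltgtP 0 a; last by rewrite -ae eqxx in a0.
  have bp : 0 < b by rewrite -(pmulr_rgt0 _ ap).
  by rewrite divr_ge0 ?ler_pdivrMr ?mul1r; lra.
have bn : b < 0 by rewrite -(nmulr_rgt0 _ an).
rewrite -[b / _]opprK -mulNr -mulrN -invrN.
by rewrite divr_ge0 ?ler_pdivrMr ?mul1r; lra.
Qed.

Lemma convex_zero (F : realFieldType) (p q : F) : p * q < 0 ->
  exists2 t, 0 <= t <= 1 & (1 - t) * p + t * q = 0.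
Proof.
move=> pq; have s0 : p - q != 0.
  apply/eqP => h; have E : p = q by lra.
  by move: pq; rewrite E -expr2 ltNge sqr_ge0.
exists (p / (p - q)); last by field.
have p0 : p != 0 by apply/eqP => p0; rewrite p0 mul0r ltxx in pq.
have [pp|pn|pe] := ltgtP 0 p; last by rewrite -pe eqxx in p0.
  have qn : q < 0 by rewrite -(pmulr_rlt0 _ pp).
  by rewrite divr_ge0 ?ler_pdivrMr ?mul1r; lra.
have qp : 0 < q by rewrite -(nmulr_rlt0 _ pn).
rewrite -[p / _]opprK -mulNr -mulrN -invrN.
by rewrite divr_ge0 ?ler_pdivrMr ?mul1r; lra.
Qed.

(** * Points and matrices of projective space *)

Local Notation RR := Rdefinitions.R.

Section Translation.
Variable n : nat.
Local Notation d := n.+1.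

Definition tov (v : vec) : 'cV[RR]_d := \col_i v i.
(* [inord] sends the indices that are never inspected to [0]. *)
Definition ofv (x : 'cV[RR]_d) : vec := fun i => x (inord i) 0.
Definition tom (g : mat) : 'M[RR]_d := \matrix_(i, j) g i j.
Definition ofm (g : 'M[RR]_d) : mat := fun i j => g (inord i) (inord j).

Lemma ofvK x : tov (ofv x) = x.
Proof. by apply/matrixP => i j; rewrite mxE /ofv inord_val ord1. Qed.

Lemma ofvE x (i : 'I_d) : ofv x i = x i 0.
Proof. by rewrite /ofv inord_val. Qed.

Lemma ofmK g : tom (ofm g) = g.
Proof. by apply/matrixP => i j; rewrite mxE /ofm !inord_val. Qed.

Lemma rsumE m (f : nat -> RR) : rsum m f = \sum_(i < m) f i.
Proof. by elim: m => [|m IHm] /=; rewrite ?big_ord0 // big_ord_recr /= -IHm. Qed.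

Lemma tov_act g v : tov (mat_act d g v) = tom g *m tov v.
Proof.
apply/matrixP => i j; rewrite !mxE /mat_act rsumE; apply: eq_bigr => l _.
by rewrite !mxE.
Qed.

Lemma tom_mul g h : tom (mat_mul d g h) = tom g *m tom h.
Proof.
apply/matrixP => i j; rewrite !mxE /mat_mul rsumE; apply: eq_bigr => l _.
by rewrite !mxE.
Qed.

Lemma tom_id : tom mat_id = 1%:M.
Proof.
apply/matrixP => i j; rewrite !mxE /mat_id -val_eqE /=.
by case: (PeanoNat.Nat.eqb_spec i j) => [->|/eqP/negPf ->]; rewrite ?eqxx.
Qed.

Lemma nz_vecP v : nz_vec d v <-> tov v != 0.
Proof.
split=> [[i [/ssrnat.ltP id vi]]|v0].
  apply/eqP => /matrixP/(_ (Ordinal id) 0); rewrite !mxE; exact: vi.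
apply: contrapT => nz; case/eqP: v0; apply/matrixP => i j; rewrite !mxE.
by apply: contrapT => vi; apply: nz; exists i; split=> //; exact/ssrnat.ltP.
Qed.

Lemma pt_eqP v w : pt_eq d v w <->
  tov w != 0 /\ exists2 c : RR, c != 0 & tov v = c *: tov w.
Proof.
split=> [[/nz_vecP v0 [/nz_vecP w0 [c [c0 vw]]]]|[w0 [c c0 vw]]].
  split=> //; exists c; first exact/eqP.
  by apply/matrixP => i j; rewrite !mxE; apply: vw; exact/ssrnat.ltP.
split; first by apply/nz_vecP; rewrite vw scaler_eq0 negb_or c0 w0.
split; first exact/nz_vecP.
exists c; split=> [|i /ssrnat.ltP id]; first exact/eqP.
by move/matrixP: vw => /(_ (Ordinal id) 0); rewrite !mxE.
Qed.

Lemma mat_peqP g h : mat_peq d g h <-> exists2 c : RR, c != 0 & tom g = c *: tom h.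
Proof.
split=> [[c [c0 gh]]|[c c0 gh]]; exists c; try exact/eqP.
  by apply/matrixP => i j; rewrite !mxE; apply: gh; exact/ssrnat.ltP.
split=> [|i j /ssrnat.ltP id /ssrnat.ltP jd]; first exact/eqP.
by move/matrixP: gh => /(_ (Ordinal id) (Ordinal jd)); rewrite !mxE.
Qed.

Lemma invertibleP g : invertible d g <-> tom g \in unitmx.
Proof.
split=> [[h gh]|gu].
  suff /mulmx1_unit[] : tom g *m tom h = 1%:M by [].
  rewrite -tom_mul -tom_id; apply/matrixP => i j; rewrite !mxE; apply: gh; exact/ssrnat.ltP.
exists (ofm (invmx (tom g))) => i j /ssrnat.ltP id /ssrnat.ltP jd.
have : tom (mat_mul d g (ofm (invmx (tom g)))) = tom mat_id.
  by rewrite tom_mul ofmK mulmxV // tom_id.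
by move=> /matrixP/(_ (Ordinal id) (Ordinal jd)); rewrite !mxE.
Qed.

Lemma fvalE f v : fval d f v = fv (tov f)^T (tov v).
Proof.
by rewrite /fval rsumE /fv mxE; apply: eq_bigr => i _; rewrite !mxE.
Qed.

Lemma vnormE v : vnorm d v = eucl (tov v).
Proof.
rewrite /vnorm RsqrtE rsumE; congr Num.sqrt; apply: eq_bigr => i _.
by rewrite big_ord1 !mxE expr2.
Qed.

Lemma mnormE g : mnorm d g = eucl (tom g).
Proof.
rewrite /mnorm RsqrtE rsumE; congr Num.sqrt; apply: eq_bigr => i _.
by rewrite rsumE; apply: eq_bigr => j _; rewrite !mxE expr2.
Qed.

Lemma pdistE v w : pdist d v w = edist (tov v) (tov w).
Proof.
rewrite /pdist RminE !vnormE /edist; congr Order.min; congr eucl.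
  by apply/matrixP => i j; rewrite !mxE ![_^-1 * _]mulrC.
by apply/matrixP => i j; rewrite !mxE ![_^-1 * _]mulrC.
Qed.

Lemma mdistE g h : mdist d g h = edist (tom g) (tom h).
Proof.
rewrite /mdist RminE !mnormE /edist; congr Order.min; congr eucl.
  by apply/matrixP => i j; rewrite !mxE ![_^-1 * _]mulrC.
by apply/matrixP => i j; rewrite !mxE ![_^-1 * _]mulrC.
Qed.

Lemma pset_scale S v w (c : RR) : pset d S -> c != 0 -> tov v = c *: tov w -> S w -> S v.
Proof.
move=> [Snz Seq] c0 vw Sw; have /nz_vecP w0 := Snz _ Sw.
apply: (Seq w) => //; apply/pt_eqP; split.
  by rewrite vw scaler_eq0 negb_or c0.
by exists c^-1; rewrite ?invr_eq0 // vw scalerA mulVf // scale1r.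
Qed.

Lemma open_P_opn U : open_P d U -> opn (fun x => U (ofv x) /\ x != 0).
Proof.
move=> oU x [/oU[e [/RltP e0 eU]] x0].
have [r r0 H] := edist_near x0 e0; exists r => // y /H[y0 xy]; split=> //.
by apply: eU; [apply/nz_vecP; rewrite ofvK|apply/RltP; rewrite pdistE !ofvK].
Qed.

(** Equivalent vectors are at distance zero, so open sets are saturated without being assumed to be
    projective sets. *)
Lemma open_P_pt_eq U v w : open_P d U -> tov v != 0 -> U v -> pt_eq d w v -> U w.
Proof.
move=> oU v0 /oU[e [/RltP e0 eU]] /pt_eqP[_ [c c0 wv]]; apply: eU.
  by apply/nz_vecP; rewrite wv scaler_eq0 negb_or c0.
by apply/RltP; rewrite pdistE wv edist_scale.
Qed.

End Translation.

Lemma opn_fv_gt0 (R : realType) m (f : 'rV[R]_m) : opn (fun x => 0 < fv f x).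
Proof.
move=> x fx; have f1 : 0 < nrm f + 1 by have := nrm_ge0 f; lra.
exists (fv f x / (nrm f + 1)); first exact: divr_gt0.
move=> y; rewrite ltr_pdivlMr // => yx.
have : `|fv f (y - x)| <= nrm f * nrm (y - x).
  by apply: le_trans (nrmM _ _); exact: entry_le_nrm.
rewrite fvD fvN ler_norml => /andP[h _]; have := nrm_ge0 (y - x).
by move: yx h; rewrite mulrDr mulr1 [_ * nrm f]mulrC; lra.
Qed.

(** * Positive lifts of convex projective sets *)

Section Cones.
Variable n : nat.
Local Notation d := n.+1.
Local Notation tov := (@tov n).
Local Notation tom := (@tom n).
Local Notation ofv := (@ofv n).
Local Notation ofm := (@ofm n).

Lemma pset_ofv_scale S x (c : RR) : pset d S -> c != 0 -> S (ofv x) -> S (ofv (c *: x)).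
Proof. by move=> pS c0; apply: (pset_scale pS c0); rewrite !ofvK. Qed.

Lemma pset_tov S v : pset d S -> S v <-> S (ofv (tov v)).
Proof.
move=> pS; split; apply: (pset_scale pS (oner_neq0 _)); by rewrite ofvK scale1r.
Qed.

Lemma pset_act S g x : pset d S -> x != 0 ->
  (forall v, nz_vec d v -> (S (mat_act d g v) <-> S v)) ->
  S (ofv (tom g *m x)) <-> S (ofv x).
Proof.
move=> pS x0 H; have /H <- : nz_vec d (ofv x) by apply/nz_vecP; rewrite ofvK.
by split; apply: (pset_scale pS (oner_neq0 _)); rewrite !(ofvK, tov_act) scale1r.
Qed.

Lemma subgroup_scale G g h (c : RR) : subgroup d G -> c != 0 ->
  tom g = c *: tom h -> G h -> G g.
Proof.
move=> [_ [Gpeq _]] c0 gh Gh; apply: (Gpeq h) => //; apply/mat_peqP.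
by exists c^-1; rewrite ?invr_eq0 // gh scalerA mulVf // scale1r.
Qed.

Lemma subgroup_mul G g h : subgroup d G -> G (ofm g) -> G (ofm h) -> G (ofm (g *m h)).
Proof.
move=> sG Gg Gh; apply: (subgroup_scale (h := mat_mul d (ofm g) (ofm h)) sG (oner_neq0 _)).
  by rewrite tom_mul !ofmK scale1r.
by case: sG => _ [_ [_ [H _]]]; apply: H.
Qed.

Lemma subgroup_inv G g : subgroup d G -> G (ofm g) -> G (ofm (invmx g)).
Proof.
move=> sG Gg; have [Gu [_ [_ [_ /(_ _ Gg)[h [Gh]]]]]] := sG.
have /invertibleP := Gu _ Gg; rewrite ofmK => gu.
move=> /mat_peqP[c c0]; rewrite tom_mul ofmK tom_id => gh.
apply: (subgroup_scale (c := c^-1) sG _ _ Gh); first by rewrite invr_eq0.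
rewrite ofmK -[tom h](mulKmx gu) gh -scalemxAr mulmx1 scalerA mulVf // scale1r //.
Qed.

(** The preimage of [S] in vector space has two opposite sheets when [F] does not vanish on [S];
    this is the sheet where [F] is positive. *)
Definition pos_lift (F : 'rV[RR]_d) (S : vec -> Prop) (x : 'cV[RR]_d) : Prop :=
  S (ofv x) /\ 0 < fv F x.

Lemma pos_lift_exists F S v : pset d S -> S v -> fv F (tov v) != 0 ->
  exists2 s : RR, s != 0 & pos_lift F S (s *: tov v).
Proof.
move=> pS Sv v0; exists (fv F (tov v))^-1; first by rewrite invr_eq0.
split; last by rewrite fvZ mulVf.
apply: pset_ofv_scale => //; first by rewrite invr_eq0.
by have [h _] := pset_tov v pS; apply: h.
Qed.

(** The chart [f] witnessing convexity may differ from [F]. If [f] has the same sign at [x] and [y],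
    the sum is a point of the segment in that chart; with opposite signs the segment would cross
    [F = 0], which [S] avoids. *)
Lemma pos_lift_cone F S f : pset d S -> chart_convex d f S ->
  (forall v, S v -> fv F (tov v) != 0) -> cone (pos_lift F S).
Proof.
move=> pS [fS Sconv] FS; split=> [x y [Sx Fx] [Sy Fy]|c x c0 [Sx Fx]]; last first.
  by split; [apply: pset_ofv_scale => //; rewrite gt_eqF|rewrite fvZ mulr_gt0].
split; last by rewrite fvD addr_gt0.
pose a := fv (tov f)^T x; pose b := fv (tov f)^T y.
have /eqP a0 : a <> 0 by have := fS _ Sx; rewrite fvalE ofvK.
have /eqP b0 : b <> 0 by have := fS _ Sy; rewrite fvalE ofvK.
have seg (t : RR) : 0 <= t <= 1 -> S (ofv (((1 - t) / a) *: x + (t / b) *: y)).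
  move=> /andP[/RleP t0 /RleP t1].
  have := Sconv _ _ t Sx Sy (conj t0 t1); apply: (pset_scale pS (oner_neq0 _)).
  rewrite ofvK scale1r; apply/matrixP => i j; rewrite !mxE.
  rewrite !fvalE !ofvK -/a -/b !ofvE ord1.
  rewrite RplusE !RmultE !RdivE RminusE R1E; ring.
have [ab|ab|ab] := ltgtP 0 (a * b).
- have [t [t01 s0 t1 t2]] := convex_parameter ab.
  have := seg t t01; rewrite t1 t2 -scalerDr.
  by move=> /(pset_ofv_scale pS s0); rewrite scalerA divff // scale1r.
- have pq : (fv F x / a) * (fv F y / b) < 0.
    rewrite mulrACA -invfM pmulr_rlt0 ?mulr_gt0 // invr_lt0 //.
  have [t t01 tE] := convex_zero pq.
  have /FS := seg t t01; rewrite ofvK fvD !fvZ.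
  by rewrite mulrAC -mulrA (mulrAC t) -(mulrA t) tE eqxx.
by move/eqP: ab; rewrite eq_sym mulf_eq0 (negPf a0) (negPf b0).
Qed.

End Cones.

(** * From a naive convex co-compact triple to cones and back *)

Section Triple.
Variables (n : nat) (Om C : vec -> Prop) (L A : mat -> Prop) (f : vec) (M : RR).
Local Notation d := n.+1.
Local Notation tov := (@tov n).
Local Notation tom := (@tom n).
Local Notation ofv := (@ofv n).
Local Notation ofm := (@ofm n).
Hypothesis Om_pset : pset d Om.
Hypothesis Om_chart : chart_convex d f Om.
Hypothesis Om_bounded : forall v, Om v ->
  Rdefinitions.Rle (vnorm d (fun i => Rdefinitions.Rdiv (v i) (fval d f v))) M.
Hypothesis Om_open : open_P d Om.
Hypothesis L_subgroup : subgroup d L.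
Hypothesis L_discrete : discrete_group d L.
Hypothesis L_Aut : forall g, L g -> in_Aut d Om g.
Hypothesis C_pset : pset d C.
Hypothesis C_ex : exists v, C v.
Hypothesis C_Om : forall v, C v -> Om v.
Hypothesis C_closed : closed_in d Om C.
Hypothesis C_convex : convex_P d C.
Hypothesis L_C : forall g v, L g -> nz_vec d v -> (C (mat_act d g v) <-> C v).
Hypothesis L_quot : quotient_compact d L C.
Hypothesis A_subgroup : subgroup d A.
Hypothesis A_L : forall a, A a -> L a.
Hypothesis A_abelian : abelian d A.
Hypothesis A_max : forall B, subgroup d B -> (forall a, A a -> B a) -> (forall b, B b -> L b) ->
  abelian d B -> forall b, B b -> A b.

Let F := (tov f)^T.
Let tOm := pos_lift F Om.
Let tC := pos_lift F C.

Lemma chart_neq0 v : Om v -> fv F (tov v) != 0.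
Proof. by move=> /(proj1 Om_chart)/eqP; rewrite fvalE. Qed.

Lemma lift_domain_cone : cone tOm.
Proof. exact: (pos_lift_cone Om_pset Om_chart chart_neq0). Qed.

Lemma lift_set_cone : cone tC.
Proof.
have [f' [_ f'C]] := C_convex.
exact: (pos_lift_cone C_pset f'C (fun v Cv => chart_neq0 (C_Om Cv))).
Qed.

Lemma lift_domain_opn : opn tOm.
Proof.
move=> x [Ox Fx]; have x0 : x != 0.
  by apply: contraTneq Fx => ->; rewrite /fv mulmx0 mxE ltxx.
have [e e0 H] := open_P_opn Om_open (conj Ox x0).
have [r r0 H'] := opn_fv_gt0 Fx.
exists (Num.min e r); first by rewrite lt_min e0 r0.
by move=> y; rewrite lt_min => /andP[/H[Oy _] /H' Fy].
Qed.

Lemma lift_domain_neq0 x : tOm x -> x != 0.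
Proof. by move=> [_]; apply: contraTneq => ->; rewrite /fv mulmx0 mxE ltxx. Qed.

Lemma lift_domain_bnd x : tOm x -> nrm x <= (d * 1)%:R * `|M| * fv F x.
Proof.
move=> [Ox Fx]; have /RleP := Om_bounded Ox.
rewrite vnormE (_ : tov _ = (fv F x)^-1 *: x); last first.
  by apply/matrixP => i j; rewrite !mxE RdivE fvalE ofvK !ofvE ord1 mulrC.
rewrite euclZ gtr0_norm ?invr_gt0 // mulrC ler_pdivrMr // => xM.
apply: le_trans (nrm_le_eucl _) _; rewrite -mulrA ler_wpM2l // (le_trans xM) //.
by rewrite ler_wpM2r ?(ltW Fx) // ler_norm.
Qed.

Lemma lift_set_domain x : tC x -> tOm x.
Proof. by move=> [Cx Fx]; split=> //; exact: C_Om. Qed.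

Lemma lift_set_cls x : tOm x -> cls tC x -> tC x.
Proof.
move=> Ox clx; have [Ox' Fx] := Ox; split=> //; apply: C_closed => // e /RltP e0.
have [r r0 H] := edist_near (lift_domain_neq0 Ox) e0.
have [y [Cy _] /H[y0 xy]] := clx r r0; exists (ofv y); split=> //.
by apply/RltP; rewrite pdistE !ofvK.
Qed.

Lemma lift_set_ex : exists x, tC x.
Proof.
have [v Cv] := C_ex; have [s _ Hs] := pos_lift_exists C_pset Cv (chart_neq0 (C_Om Cv)).
by exists (s *: tov v).
Qed.

(** Of the two signs of a representative, the one preserving the positive sheet; positive multiples
    all remain. *)
Definition pos_group (G : mat -> Prop) (g : 'M[RR]_d) : Prop :=
  G (ofm g) /\ forall x, tOm x -> tOm (g *m x).

Lemma aut_act g x : L (ofm g) -> tOm x -> Om (ofv (g *m x)).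
Proof.
move=> Lg Ox; have [_ H] := L_Aut Lg.
have := pset_act Om_pset (lift_domain_neq0 Ox) H; rewrite ofmK => E.
by apply/E; case: Ox.
Qed.

(** One point decides the sign: if [g] sent [x] and [y] to opposite sheets, a positive combination
    of them would be sent to [F = 0]. *)
Lemma pos_group_of_point G g x : (forall g, G g -> L g) -> G (ofm g) ->
  tOm x -> 0 < fv F (g *m x) -> pos_group G g.
Proof.
move=> GL Gg Ox Fgx; have Lg := GL _ Gg; split=> // y Oy.
split; first exact: aut_act.
rewrite ltNge; apply/negP => Fgy.
have Fgy' : fv F (g *m y) < 0.
  rewrite lt_neqAle Fgy andbT; have := chart_neq0 (aut_act Lg Oy); by rewrite ofvK.
have [OD OZ] := lift_domain_cone.
have Oz : tOm (- fv F (g *m y) *: x + fv F (g *m x) *: y).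
  by apply: OD; apply: OZ => //; rewrite oppr_gt0.
have := chart_neq0 (aut_act Lg Oz); rewrite ofvK mulmxDr -!scalemxAr fvD !fvZ.
by rewrite mulNr mulrC addNr eqxx.
Qed.

Lemma pos_group_exists G g : (forall g, G g -> L g) -> subgroup d G -> G g ->
  exists2 s : RR, s != 0 & pos_group G (s *: tom g).
Proof.
move=> GL sG Gg; have [x /lift_set_domain Ox] := lift_set_ex.
have Gg' : G (ofm (tom g)).
  by apply: (subgroup_scale sG (oner_neq0 _) _ Gg); rewrite ofmK scale1r.
have := chart_neq0 (aut_act (GL _ Gg') Ox); rewrite ofvK => F0.
exists (fv F (tom g *m x))^-1; first by rewrite invr_eq0.
apply: (pos_group_of_point GL _ Ox); last by rewrite -scalemxAl fvZ mulVf.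
by apply: (subgroup_scale (c := (fv F (tom g *m x))^-1) sG _ _ Gg); rewrite ?invr_eq0 ?ofmK.
Qed.

Section Subgroup.
Variable G : mat -> Prop.
Hypothesis G_L : forall g, G g -> L g.
Hypothesis G_sub : subgroup d G.

Lemma pos_group_unit g : pos_group G g -> g \in unitmx.
Proof. by move=> [Gg _]; have /invertibleP := proj1 G_sub _ Gg; rewrite ofmK. Qed.

Lemma pos_group_mul g h : pos_group G g -> pos_group G h -> pos_group G (g *m h).
Proof.
move=> [Gg Og] [Gh Oh]; split; first exact: subgroup_mul.
by move=> x /Oh/Og; rewrite mulmxA.
Qed.

Lemma pos_group_inv g : pos_group G g -> pos_group G (invmx g).
Proof.
move=> Pg; have gu := pos_group_unit Pg; have [Gg Og] := Pg.
have Gi : G (ofm (invmx g)) by exact: subgroup_inv.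
have [x /lift_set_domain Ox] := lift_set_ex.
by apply: (pos_group_of_point G_L Gi (Og _ Ox)); rewrite mulKmx //; case: Ox.
Qed.

Lemma pos_group_scale (c : RR) g : 0 < c -> pos_group G g -> pos_group G (c *: g).
Proof.
move=> c0 [Gg Og]; split.
  by apply: (subgroup_scale (c := c) G_sub _ _ Gg); rewrite ?ofmK ?gt_eqF.
by move=> x /Og Ox; rewrite -scalemxAl; apply: (proj2 lift_domain_cone).
Qed.

Lemma pos_group1 : pos_group G 1%:M.
Proof.
split; last by move=> x; rewrite mul1mx.
have [_ [_ [G1 _]]] := G_sub; apply: (subgroup_scale G_sub (oner_neq0 _) _ G1).
by rewrite ofmK tom_id scale1r.
Qed.

End Subgroup.

Let tL := pos_group L.
Let tA := pos_group A.
Let LL g (Lg : L g) := Lg.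

Lemma pos_group_set g x : tL g -> tC x -> tC (g *m x).
Proof.
move=> [Lg Og] Cx; have Ox := lift_set_domain Cx; have [Cx' _] := Cx.
split; last by case: (Og _ Ox).
have := pset_act C_pset (lift_domain_neq0 Ox) (L_C (g := ofm g) ^~ Lg); rewrite ofmK.
by case=> _; apply.
Qed.

Lemma pos_group_discrete : exists2 e : RR, 0 < e &
  forall g, tL g -> nrm (g - 1%:M) < e -> exists c : RR, g = c%:M.
Proof.
have [_ [_ [L1 _]]] := L_subgroup; have [e [/RltP e0 He]] := L_discrete L1.
have [r r0 H] := edist_near (oner_neq0 'M[RR]_d) e0.
exists r => // g [Lg _] /H[g0 ge].
have /mat_peqP[c c0] : mat_peq d mat_id (ofm g).
  by apply: He => //; apply/RltP; rewrite mdistE tom_id ofmK.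
rewrite tom_id ofmK => E; exists c^-1.
by rewrite -scalemx1 E scalerA mulVf // scale1r.
Qed.

Lemma pos_group_cobounded u : tOm u -> exists c : RR, forall x, tC x ->
  exists g, [/\ tL g, tOm (c *: u - g *m x) & tOm (c *: (g *m x) - u)].
Proof.
(* [U m] collects the points that some element of the group moves into the order interval of
   constant [m] around [u]. These sets are invariant and relatively open, so finitely many of them
   cover. *)
move=> Ou; pose U (m : nat) (v : vec) := exists2 g, L (ofm g) &
  [/\ tOm (g *m tov v), tOm (m%:R *: u - g *m tov v) & tOm (m%:R *: (g *m tov v) - u)].
have [m v Cv [g Lg [g1 g2 g3]]|m h v Lh Cv [g Lg Hg]|v Cv|l Hl] := L_quot (U := U).
- have v0 : tov v != 0 by apply/nz_vecP; case: C_pset => H _; exact: H.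
  have [e1 e10 He1] := lift_domain_opn g1.
  have [e2 e20 He2] := lift_domain_opn g2.
  have [e3 e30 He3] := lift_domain_opn g3.
  (* One factor absorbs the action of [g], the other the coefficient [m] in the third condition. *)
  pose N := (nrm g + 1) * (m%:R + 1).
  have ng := nrm_ge0 g; have m0 : 0 <= m%:R :> RR by [].
  have N0 : 0 < N by apply: mulr_gt0; lra.
  pose e := Num.min e1 (Num.min e2 e3) / N.
  have e0 : 0 < e by rewrite divr_gt0 // !lt_min e10 e20 e30.
  have [r r0 Hr] := edist_approx v0 e0.
  exists r; split; first exact/RltP.
  move=> w Cw /RltP; rewrite pdistE => vw.
  have w0 : tov w != 0 by apply/nz_vecP; case: C_pset => H _; exact: H.
  (* The projective distance controls [w] only up to a scalar, which is absorbed into the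
     representative of [g]. *)
  have [s s0 Hs] := Hr _ w0 vw; exists (s *: g).
    by apply: (subgroup_scale L_subgroup s0 _ Lg); rewrite !ofmK.
  rewrite -scalemxAl scalemxAr.
  set y := s *: tov w in Hs *.
  have near : nrm (g *m y - g *m tov v) * (m%:R + 1) < Num.min e1 (Num.min e2 e3).
    rewrite -mulmxBr; move: Hs; rewrite ltr_pdivlMr // => Hs; apply: le_lt_trans Hs.
    rewrite /N mulrA ler_wpM2r ?addr_ge0 //; apply: le_trans (nrmM _ _) _.
    by rewrite mulrC ler_wpM2l ?nrm_ge0 // lerDl.
  have n0 := nrm_ge0 (g *m y - g *m tov v).
  have [near1 near2] : nrm (g *m y - g *m tov v) < Num.min e1 (Num.min e2 e3) /\
      m%:R * nrm (g *m y - g *m tov v) < Num.min e1 (Num.min e2 e3).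
    by move: near; rewrite mulrDr mulr1 mulrC; have := mulr_ge0 m0 n0; lra.
  move: near1 near2; rewrite !lt_min => /and3P[h1 h2 h3] /and3P[_ _ h4].
  split; [exact: He1|apply: He2|apply: He3].
    by rewrite (_ : _ - _ = - (g *m y - g *m tov v)) ?nrmN //; vec_ring.
  rewrite (_ : _ - _ = m%:R *: (g *m y - g *m tov v)); last by vec_ring.
  by rewrite nrmZ ger0_norm.
- exists (g *m invmx (tom h)).
    apply: subgroup_mul => //; apply: subgroup_inv => //.
    by apply: (subgroup_scale L_subgroup (oner_neq0 _) _ Lh); rewrite ofmK scale1r.
  have hu : tom h \in unitmx by apply/invertibleP; case: L_subgroup => H _; exact: H.
  by rewrite tov_act -mulmxA mulKmx.
- have [s s0 Hs] := pos_lift_exists C_pset Cv (chart_neq0 (C_Om Cv)).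
  have Os := lift_set_domain Hs.
  have [t1 t10 Ht1] := opn_order_unit (s *: tov v) lift_domain_cone lift_domain_opn Ou.
  have [t2 t20 Ht2] := opn_order_unit u lift_domain_cone lift_domain_opn Os.
  exists (Num.truncn (t1 + t2)).+1, (s *: 1%:M).
    have [_ [_ [L1 _]]] := L_subgroup; apply: (subgroup_scale L_subgroup s0 _ L1).
    by rewrite ofmK tom_id.
  have /andP[_ ht] : (Num.truncn (t1 + t2))%:R <= t1 + t2 < (Num.truncn (t1 + t2)).+1%:R.
    by apply: truncn_itv; lra.
  rewrite -scalemxAl mul1mx; split=> //.
    by apply: order_unit_mono Ht1 => //; [exact: lift_domain_cone|lra].
  by apply: order_unit_mono Ht2 => //; [exact: lift_domain_cone|lra].
pose c : RR := \sum_(m <- l) m%:R; exists c => x Cx; have Ox := lift_set_domain Cx.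
have [m [lm]] := Hl (ofv x) (proj1 Cx); rewrite /U ofvK => -[g Lg [g1 g2 g3]].
exists g; have Lg' : tL g.
  by apply: (pos_group_of_point LL Lg Ox); case: g1.
have mc : m%:R <= c.
  rewrite /c; elim: l lm {Hl c} => [//|m' l IHl] [->|/IHl h]; rewrite big_cons.
    by rewrite lerDl sumr_ge0.
  by rewrite ler_wpDl.
split=> //; [apply: order_unit_mono g2|apply: order_unit_mono g3] => //; exact: lift_domain_cone.
Qed.

Lemma pos_group_comm a b : tA a -> tA b -> a *m b = b *m a.
Proof.
move=> Ta Tb; have [x /lift_set_domain Ox] := lift_set_ex.
have [[Aa Oa] [Ab Ob]] := (Ta, Tb).
have tLa : tL a by split=> //; exact: A_L.
have tLb : tL b by split=> //; exact: A_L.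
have /mat_peqP[c c0] := A_abelian Aa Ab; rewrite !tom_mul !ofmK => E.
apply: (projectively_commuting (Om := tOm) (L := tL) (f := F) _ _ _ _ Ox tLa tLb E).
- by move=> y [].
- exact: (pos_group_unit L_subgroup).
- exact: (pos_group_mul L_subgroup).
- by move=> g y [_]; apply.
Qed.

(** Maximality is applied to the group generated by [A] and [b], whose elements are the nonzero
    multiples of [a b^z]. *)
Lemma pos_group_maximal b : tL b -> (forall a, tA a -> b *m a = a *m b) -> tA b.
Proof.
move=> Lb bA; split; last by case: Lb.
have bu := pos_group_unit L_subgroup Lb.
pose B g := exists a (z : int) (s : RR), [/\ tA a, s != 0 & tom g = s *: (a *m b ^ z)].
have bz z : tL (b ^ z).
  have bn m : tL (b ^+ m).
    elim: m => [|m IHm]; first exact: (pos_group1 L_subgroup).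
    by rewrite exprS; apply: (pos_group_mul L_subgroup).
  case: z => m; first exact: bn.
  by apply: (pos_group_inv LL L_subgroup); exact: bn.
have comm a z : tA a -> a *m b ^ z = b ^ z *m a.
  by move=> Ta; apply: commrXz; rewrite /GRing.comm -!mulmxE bA.
have prod a z a' z' : tA a -> tA a' ->
    (a *m b ^ z) *m (a' *m b ^ z') = (a *m a') *m b ^ (z + z').
  move=> Ta Ta'; rewrite exprzDr // mulmxA -(mulmxA a) -comm //.
  by rewrite !mulmxA.
have AL := pos_group_mul A_subgroup.
apply: (A_max (B := B)).
- split=> [g [a [z [s [Ta s0 E]]]]|].
    apply/invertibleP; rewrite E unitmxZ ?unitfE // unitmx_mul.
    by rewrite (pos_group_unit A_subgroup Ta) (pos_group_unit L_subgroup (bz z)).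
  split=> [g h [a [z [s [Ta s0 E]]]] /mat_peqP[c c0 gh]|].
    exists a, z, (c^-1 * s); split=> //; first by rewrite mulf_neq0 ?invr_eq0.
    by rewrite -scalerA -E gh scalerA mulVf // scale1r.
  split.
    exists 1%:M, 0, 1; split; [exact: (pos_group1 A_subgroup)|exact: oner_neq0|].
    by rewrite tom_id scale1r mulmx1.
  split=> [g h [a [z [s [Ta s0 E]]]] [a' [z' [s' [Ta' s'0 E']]]]|g [a [z [s [Ta s0 E]]]]].
    exists (a *m a'), (z + z'), (s * s'); split; [exact: AL|exact: mulf_neq0|].
    by rewrite tom_mul E E' -scalemxAl -scalemxAr scalerA prod.
  have Ti := pos_group_inv A_L A_subgroup Ta.
  exists (ofm (invmx a *m b ^ (- z))); split.
    by exists (invmx a), (- z), 1; rewrite ofmK scale1r oner_neq0.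
  apply/mat_peqP; exists s => //; rewrite tom_mul ofmK E -scalemxAl prod // subrr.
  by rewrite expr0z mulmx1 mulmxV ?tom_id // (pos_group_unit A_subgroup Ta).
- move=> a Aa; have [s s0 Ts] := pos_group_exists A_L A_subgroup Aa.
  exists (s *: tom a), 0, s^-1; split; rewrite ?invr_eq0 //.
  by rewrite expr0z mulmx1 scalerA mulVf // scale1r.
- move=> g [a [z [s [Ta s0 E]]]].
  have [La _] : tL (a *m b ^ z).
    apply: (pos_group_mul L_subgroup) (bz z).
    by case: Ta => Aa Oa; split=> //; exact: A_L.
  by apply: (subgroup_scale L_subgroup s0 _ La); rewrite ofmK.
- move=> g h [a [z [s [Ta s0 E]]]] [a' [z' [s' [Ta' s'0 E']]]].
  apply/mat_peqP; exists 1; first exact: oner_neq0.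
  rewrite scale1r !tom_mul E E' -!scalemxAl -!scalemxAr !prod // addrC.
  by rewrite (pos_group_comm Ta Ta') !scalerA mulrC.
exists 1%:M, 1, 1; rewrite ofmK scale1r mul1mx expr1z.
by split=> //; [exact: (pos_group1 A_subgroup)|exact: oner_neq0].
Qed.

(** * The projective simplex, its compactness properties and the free abelian subgroup *)

Section Conclusion.
Variables (k : nat) (w : 'I_k.+1 -> 'cV[RR]_d).
Let tS x := exists2 c : 'I_k.+1 -> RR, (forall i, 0 < c i) & x = \sum_i c i *: w i.
Hypothesis w_ind : forall c : 'I_k.+1 -> RR, \sum_i c i *: w i = 0 -> forall i, c i = 0.
Hypothesis tS_tC : forall x, tS x -> tC x.
Hypothesis tS_cls : forall x, tOm x -> cls tS x -> tS x.
Hypothesis w_eig : forall a i, tA a -> exists2 c : RR, 0 < c & a *m w i = c *: w i.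

Definition proj_simplex (v : vec) : Prop :=
  exists2 s : RR, s != 0 & exists2 x, tS x & tov v = s *: x.

Lemma proj_simplex_pset : pset d proj_simplex.
Proof.
split=> [v [s s0 [x Sx vx]]|v v' /pt_eqP[v'0 [c c0 vv']] [s s0 [x Sx vx]]].
  apply/nz_vecP; rewrite vx scaler_eq0 negb_or s0.
  exact: lift_domain_neq0 (lift_set_domain (tS_tC Sx)).
exists (c^-1 * s); first by rewrite mulf_neq0 ?invr_eq0.
by exists x => //; rewrite -scalerA -vx vv' scalerA mulVf // scale1r.
Qed.

Lemma proj_simplex_set v : proj_simplex v -> C v.
Proof.
move=> [s s0 [x /tS_tC[Cx _] vx]].
by apply: (pset_scale C_pset s0 _ Cx); rewrite ofvK.
Qed.

Lemma scale_tS (s : RR) x : tS x -> 0 < fv F (s *: x) -> tS (s *: x).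
Proof.
move=> [c c0 xE]; have [_ Fx] := tS_tC (ex_intro2 _ _ c c0 xE); rewrite fvZ pmulr_lgt0 // => s0.
exists (fun i => s * c i) => [i|]; first exact: mulr_gt0.
by rewrite xE scaler_sumr; apply: eq_bigr => i _; rewrite scalerA.
Qed.

(** [tS] is closed in [tOm]; a nearby line has a representative near the chosen lift of [v], and
    membership in the simplex would put that representative in [tS]. *)
Lemma proj_simplex_complement_open : open_P d (fun v => Om v /\ ~ proj_simplex v).
Proof.
move=> v [Ov nSv]; have [s s0 Hs] := pos_lift_exists Om_pset Ov (chart_neq0 Ov).
have sv0 := lift_domain_neq0 Hs.
have v0 : tov v != 0 by apply: contraNneq sv0 => ->; rewrite scaler0.
have nS : ~ cls tS (s *: tov v).
  move=> /(tS_cls Hs) Sx; apply: nSv; exists s^-1; first by rewrite invr_eq0.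
  by exists (s *: tov v) => //; rewrite scalerA mulVf // scale1r.
have [e e0 He] : exists2 e : RR, 0 < e & forall y, nrm (y - s *: tov v) < e -> ~ tS y.
  apply: contrapT => H; apply: nS => e e0; apply: contrapT => H'.
  by apply: H; exists e => // y ye Sy; apply: H'; exists y.
have [e' e'0 He'] := lift_domain_opn Hs.
have m0 : 0 < Num.min e e' / `|s| by rewrite divr_gt0 ?normr_gt0 // lt_min e0 e'0.
have [r r0 Hr] := edist_approx v0 m0; exists r; split; first exact/RltP.
move=> v' /nz_vecP v'0 /RltP; rewrite pdistE => /(Hr _ v'0)[t t0].
rewrite ltr_pdivlMr ?normr_gt0 // mulrC -nrmZ scalerBr scalerA lt_min => /andP[near near'].
have Ov' := He' _ near'; have st0 : s * t != 0 by rewrite mulf_neq0.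
split.
  case: Ov' => Ov' _; apply: (pset_scale (c := (s * t)^-1) Om_pset _ _ Ov'); rewrite ?invr_eq0 //.
  by rewrite ofvK scalerA mulVf // scale1r.
move=> [q q0 [x Sx v'x]]; apply: (He _ near); rewrite v'x scalerA; apply: scale_tS => //.
by case: Ov' => _; rewrite v'x scalerA.
Qed.

Lemma proj_simplex_embedded : properly_embedded d proj_simplex C.
Proof.
move=> K cK KC I U Uo KSU.
(* A relatively closed subset of a compact set: the complement of the simplex in [Om] is added to
   the cover under the index [None] and discarded afterwards. *)
pose V (i : option I) := if i is Some j then U j else fun v => Om v /\ ~ proj_simplex v.
have [|v Kv|l Hl] := cK (option I) V.
- by case=> [i|]; [exact: Uo|exact: proj_simplex_complement_open].
- have [Sv|nSv] := pselect (proj_simplex v).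
    by have [|i Ui] := KSU v; [|exists (Some i)].
  by exists None; split=> //; exact/C_Om/KC.
exists (pmap id l) => v [Kv Sv]; have [[i|] [il //= Vi]] := Hl v Kv; last by case: Vi.
exists i; split=> //; elim: l il {Hl} => //= -[j|] l IHl [//|/IHl]; last by [].
- by case=> ->; left.
- by right.
Qed.

Lemma act_tS a x : tA a -> tS x -> tS (a *m x).
Proof.
move=> Ta [c c0 ->].
have /choice[h hP] i : exists h : RR, 0 < h /\ a *m w i = h *: w i.
  by have [h h0 hE] := w_eig i Ta; exists h.
exists (fun i => c i * h i) => [i|]; first by rewrite mulr_gt0 //; case: (hP i).
rewrite mulmx_sumr; apply: eq_bigr => i _; rewrite -scalemxAr.
by have [_ ->] := hP i; rewrite scalerA.
Qed.

Lemma proj_simplex_act a v : A a -> proj_simplex v -> proj_simplex (mat_act d a v).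
Proof.
move=> Aa [s s0 [x Sx vx]]; have [t t0 Ta] := pos_group_exists A_L A_subgroup Aa.
exists (t^-1 * s); first by rewrite mulf_neq0 ?invr_eq0.
exists (t *: tom a *m x); first exact: act_tS.
by rewrite tov_act vx -scalemxAr -scalemxAl scalerA mulrAC mulVf // mul1r.
Qed.

Lemma proj_simplex_invariant a v : A a -> nz_vec d v ->
  (proj_simplex (mat_act d a v) <-> proj_simplex v).
Proof.
move=> Aa v0; split; last exact: proj_simplex_act.
have au : tom a \in unitmx by apply/invertibleP; case: A_subgroup => H _; exact: H.
have Ai : A (ofm (invmx (tom a))).
  apply: subgroup_inv => //.
  by apply: (subgroup_scale A_subgroup (oner_neq0 _) _ Aa); rewrite ofmK scale1r.
move=> /(proj_simplex_act Ai); apply: (pset_scale proj_simplex_pset (oner_neq0 _)).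
by rewrite !tov_act ofmK mulKmx // scale1r.
Qed.

(** The [w i] are completed to a basis and sent to the standard one. The second clause identifies
    the vertices with the lines of the [w i], hence with common eigenlines. *)
Lemma proj_simplex_is_simplex : exists g, simplex_by d proj_simplex g k.+1 /\
  forall v, simplex_vertex d g k.+1 v -> exists2 i, tov v != 0 & exists c : RR, tov v = c *: w i.
Proof.
have [kd [G Gu GE]] := extend_to_basis w_ind.
have Gcomb (c : 'I_k.+1 -> RR) (x : vec) : (forall i : 'I_k.+1, x i = c i) ->
    (forall i, (k < i)%N -> x i = 0) -> G *m (\sum_i c i *: w i) = tov x.
  move=> xc x0; rewrite mulmx_sumr; apply/matrixP => i j; rewrite summxE mxE.
  under eq_bigr do rewrite -scalemxAr GE !mxE.
  have [ik|ik] := leqP i k; last first.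
    rewrite (x0 i ik) big1 // => l _; rewrite gtn_eqF ?mulr0 //.
    exact: leq_trans (ltn_ord l) ik.
  rewrite (bigD1 (Ordinal (ik : (i < k.+1)%N))) //= eqxx mulr1 big1 ?addr0 => [|l li].
    by rewrite -xc.
  by rewrite eq_sym -[X in X == _]/(val l) (negPf (_ : val l != i)) ?mulr0.
exists (ofm G); split.
  split; first by apply/invertibleP; rewrite ofmK.
  split; first by split; apply/ssrnat.leP.
  split; first by case: proj_simplex_pset.
  move=> v /nz_vecP v0; split=> [[s s0 [x [c c0 xE] vx]]|[x [x0 [x0' /pt_eqP[_ [s s0]]]]]].
    (* Padding with [0]: the coordinates of the standard simplex must vanish at every index beyond
       [k], including those past the dimension. *)
    pose y i : RR := if (i < k.+1)%N then c (inord i) else 0.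
    have yE : G *m x = tov y.
      rewrite xE; apply: Gcomb => i; rewrite /y; last by move=> ki; rewrite ltnS leqNgt ki.
      by rewrite ltn_ord inord_val.
    exists y; split; [|split].
    - by move=> i /ssrnat.ltP ik; apply/RltP; rewrite /y ik.
    - by move=> i /ssrnat.leP ki; rewrite /y ltnNge ki.
    apply/pt_eqP; rewrite tov_act ofmK -yE vx -scalemxAr; split; last by exists s.
    apply: contraNneq v0 => Gx; rewrite vx -(mulKmx Gu x) Gx mulmx0 scaler0.
    exact: eqxx.
  rewrite tov_act ofmK => E; exists s => //.
  exists (\sum_(i < k.+1) x i *: w i).
    by exists (fun i => x i) => // i; apply/RltP; apply: x0; exact/ssrnat.ltP.
  apply: (can_inj (mulKmx Gu)); rewrite E -scalemxAr; congr (_ *: _); apply/esym.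
  by apply: Gcomb => // i ik; apply: x0'; exact/ssrnat.leP.
move=> v [i [/ssrnat.ltP ik /pt_eqP[b0 [c c0]]]]; rewrite tov_act ofmK => E.
exists (Ordinal ik).
  apply: contraNneq b0 => v0; move: E; rewrite v0 mulmx0 => /eqP.
  by rewrite eq_sym scaler_eq0 (negPf c0).
exists c; apply: (can_inj (mulKmx Gu)); rewrite E -scalemxAr GE; congr (_ *: _).
apply/matrixP => j l; rewrite !mxE /basis /= eq_sym.
by case: (PeanoNat.Nat.eqb_spec i j) => [->|/eqP/negPf ->]; rewrite ?eqxx.
Qed.

(** The compact set consists of the lines through [K]. A projective cover is pulled back to vectors,
    reduced there, and carried back to other representatives by saturation of open sets. *)
Lemma proj_simplex_cocompact (K : 'cV[RR]_d -> Prop) (B : RR) :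
  (forall x, K x -> tS x) -> (forall x, cls K x -> K x) -> (forall x, K x -> nrm x <= B) ->
  (forall x, tS x -> exists2 a, tA a & K (a *m x)) -> acts_cocompactly d A proj_simplex.
Proof.
move=> KS Kcl KB Kcob.
have K0 x : K x -> x != 0 by move=> /KS/tS_tC/lift_set_domain/lift_domain_neq0.
exists (fun v => exists2 s : RR, s != 0 & exists2 x, K x & tov v = s *: x); split; [|split].
- move=> I U Uo KU.
  have [i|x Kx|l Hl] := heine_borel (I := I) (U := fun i x => U i (ofv x) /\ x != 0) KB Kcl.
  + exact: open_P_opn.
  + have [|i Ui] := KU (ofv x); last by exists i; split=> //; exact: K0.
    by exists 1; [exact: oner_neq0|exists x => //; rewrite ofvK scale1r].
  exists l => v [s s0 [x Kx vx]]; have [i il [Ui x0]] := Hl x Kx; exists i; split=> //.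
  apply: (open_P_pt_eq (Uo i) _ Ui); first by rewrite ofvK.
  by apply/pt_eqP; rewrite ofvK; split=> //; exists s.
- by move=> v [s s0 [x /KS Sx vx]]; exists s => //; exists x.
move=> v; split=> [[s s0 [x Sx vx]]|[a [v' [Aa [[s s0 [x /KS Sx vx]] vv']]]]].
  have [a Ta Ka] := Kcob x Sx; have Ti := pos_group_inv A_L A_subgroup Ta.
  have au := pos_group_unit A_subgroup Ta.
  exists (ofm (invmx a)), (ofv (a *m x)); split; [by case: Ti|split].
    by exists 1; [exact: oner_neq0|exists (a *m x) => //; rewrite ofvK scale1r].
  apply/pt_eqP; rewrite tov_act ofmK ofvK mulKmx //; split; last by exists s.
  exact: lift_domain_neq0 (lift_set_domain (tS_tC Sx)).
have Sv' : proj_simplex (mat_act d a v').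
  by apply: proj_simplex_act => //; exists s => //; exists x.
by move/pt_eqP: vv' => [_ [c c0 E]]; apply: (pset_scale proj_simplex_pset c0 E).
Qed.

Lemma lattice_subgroup (b : 'I_k -> 'M[RR]_d) (l : seq 'M[RR]_d) :
  (forall y z : 'I_k -> int,
     \prod_i b i ^ (y i + z i) = (\prod_i b i ^ y i) *m (\prod_i b i ^ z i)) ->
  (forall z : 'I_k -> int, tA (\prod_i b i ^ z i)) ->
  (forall (y z : 'I_k -> int) (s : RR),
     \prod_i b i ^ y i = s *: \prod_i b i ^ z i -> forall i, y i = z i) ->
  (forall h, h \in l -> tA h) ->
  (forall a, tA a -> exists h (z : 'I_k -> int) (s : RR),
     h \in l /\ a = s *: (h *m \prod_i b i ^ z i)) ->
  exists B, finite_index d B A /\ iso_Zm d k B.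
Proof.
move=> bD bA binj lA lfin.
pose phi (y : nat -> BinNums.Z) := \prod_(i < k) b i ^ int_of_Z (y i).
have phiD y z : phi (fun i => BinInt.Z.add (y i) (z i)) = phi y *m phi z.
  rewrite /phi -bD; apply: eq_bigr => i _; congr (_ ^ _).
  by rewrite -[BinInt.Z.add _ _]/(y i + z i) raddfD.
have phi0 : phi (fun=> BinNums.Z0) = 1%:M.
  by rewrite /phi big1 // => i _; rewrite expr0z.
have ofz (z : 'I_k -> int) : exists2 y, zvec k y & phi y = \prod_i b i ^ z i.
  exists (fun i => if insub i is Some j then Z_of_int (z j) else BinNums.Z0).
    by move=> i /ssrnat.leP ki; rewrite insubN // -leqNgt.
  by apply: eq_bigr => i _; rewrite valK Z_of_intK.
have zD y z : zvec k y -> zvec k z -> zvec k (fun i => BinInt.Z.add (y i) (z i)).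
  by move=> yk zk i ki; rewrite yk // zk.
(* The image of [phi] saturated under scalars, since subgroups are sets of all representatives. *)
pose B g := exists2 y, zvec k y & mat_peq d (ofm (phi y)) g.
have BA g : B g -> A g.
  move=> [y yk /mat_peqP[c c0]]; rewrite ofmK => E.
  have [Ap _] := bA (fun i => int_of_Z (y i)).
  apply: (subgroup_scale (c := c^-1) A_subgroup _ _ Ap); first by rewrite invr_eq0.
  by rewrite ofmK -/(phi y) E scalerA mulVf // scale1r.
have Binv y : zvec k y -> phi y *m phi (fun i => BinInt.Z.opp (y i)) = 1%:M.
  move=> yk; rewrite -phiD -phi0; apply: eq_bigr => i _; congr (_ ^ int_of_Z _).
  exact: BinInt.Z.add_opp_diag_r.
exists B; split.
  split; last split=> //.
    split; first by move=> g /BA Ag; case: A_subgroup => H _; exact: H.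
    split.
      move=> g h [y yk /mat_peqP[c c0 E]] /mat_peqP[c' c'0 E']; exists y => //.
      by apply/mat_peqP; exists (c * c'); rewrite ?mulf_neq0 // E E' scalerA.
    split.
      exists (fun=> BinNums.Z0) => //; apply/mat_peqP; exists 1; first exact: oner_neq0.
      by rewrite ofmK tom_id phi0 scale1r.
    split.
      move=> g h [y yk /mat_peqP[c c0 E]] [z zk /mat_peqP[c' c'0 E']].
      exists (fun i => BinInt.Z.add (y i) (z i)); first exact: zD.
      apply/mat_peqP; exists (c * c'); first by rewrite mulf_neq0.
      move: E E'; rewrite !ofmK => E E'.
      by rewrite phiD E E' tom_mul -scalemxAl -scalemxAr scalerA.
    move=> g [y yk /mat_peqP[c c0]]; rewrite ofmK => E.
    exists (ofm (phi (fun i => BinInt.Z.opp (y i)))); split.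
      exists (fun i => BinInt.Z.opp (y i)); first by move=> i ki; rewrite yk.
      by apply/mat_peqP; exists 1; [exact: oner_neq0|rewrite scale1r].
    apply/mat_peqP; exists c^-1; first by rewrite invr_eq0.
    rewrite tom_mul ofmK tom_id -(Binv y yk) E -scalemxAl scalerA mulVf //.
    by rewrite scale1r.
  exists (map ofm l); split.
    move=> h; elim: l lA {lfin} => //= h' l IHl lA [<-|]; last first.
      by apply: IHl => h'' hl; apply: lA; rewrite inE hl orbT.
    by case: (lA h' (mem_head _ _)).
  move=> a Aa; have [s s0 Ta] := pos_group_exists A_L A_subgroup Aa.
  have [h [z [t [hl E]]]] := lfin _ Ta; have [y yk yE] := ofz z.
  exists (ofm h), (ofm (phi y)); split; [|split].
  - elim: l hl {lA lfin} => //= h' l IHl; rewrite inE => /orP[/eqP ->|/IHl]; by [left|right].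
  - by exists y => //; apply/mat_peqP; exists 1; [exact: oner_neq0|rewrite scale1r].
  have t0 : t != 0.
    apply: contraTneq (pos_group_unit A_subgroup Ta) => t0; rewrite E t0 scale0r.
    by rewrite unitmxE det0 unitr0.
  apply/mat_peqP; exists (s^-1 * t); first by rewrite mulf_neq0 ?invr_eq0.
  by rewrite tom_mul !ofmK yE -scalerA -E scalerA mulVf // scale1r.
exists (fun y => ofm (phi y)); split; [|split; [|split]].
- by move=> y yk; exists y => //; apply/mat_peqP; exists 1; [exact: oner_neq0|rewrite scale1r].
- move=> y z yk zk; apply/mat_peqP; exists 1; first exact: oner_neq0.
  by rewrite tom_mul !ofmK phiD scale1r.
- move=> y z yk zk /mat_peqP[c c0]; rewrite !ofmK => /binj H i.
  have [ik|ki] := ltnP i k; last by rewrite yk ?zk //; exact/ssrnat.leP.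
  by have /(congr1 Z_of_int) := H (Ordinal ik); rewrite !int_of_ZK.
- by move=> g [y yk E]; exists y.
Qed.

End Conclusion.

Theorem flat_torus_of_triple : exists (S : vec -> Prop) (g : mat) (k : nat),
  simplex_by d S g k /\
  (forall v, S v -> C v) /\
  properly_embedded d S C /\
  (forall a v, A a -> nz_vec d v -> (S (mat_act d a v) <-> S v)) /\
  acts_cocompactly d A S /\
  (forall a v, A a -> simplex_vertex d g k v -> pt_eq d (mat_act d a v) v) /\
  (exists B, finite_index d B A /\ iso_Zm d (Nat.sub k 1) B).
Proof.
have [u Cu] := lift_set_ex; have Ou := lift_set_domain Cu.
have Mb0 : 0 <= (d * 1)%:R * `|M| by rewrite mulr_ge0.
have [k [w [[w_ind SC Scls w_eig] [[K [KS Kcl [Bd KB] Kcob]] [b [bA bD bP binj [l lA lfin]]]]]]] :=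
  cone_flat_torus lift_domain_cone lift_domain_opn (fun x (H : tOm x) => proj2 H) Mb0
    lift_domain_bnd (pos_group_unit L_subgroup) (pos_group_mul L_subgroup)
    (pos_group_inv LL L_subgroup) (fun g x (H : tL g) => proj2 H x) pos_group_discrete
    lift_set_domain lift_set_cone lift_set_cls lift_set_ex pos_group_set Ou (pos_group_cobounded Ou)
    (fun a (H : tA a) => conj (A_L (proj1 H)) (proj2 H) : tL a)
    (pos_group1 A_subgroup) (pos_group_mul A_subgroup) (pos_group_inv A_L A_subgroup)
    (pos_group_scale A_subgroup) pos_group_comm pos_group_maximal.
have [g [gS gV]] := proj_simplex_is_simplex w_ind SC.
exists (proj_simplex w), g, k.+1; split=> //.
split; first by move=> v; exact: proj_simplex_set.
split; first exact: proj_simplex_embedded.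
split; first by move=> a v; exact: proj_simplex_invariant.
split; first exact: proj_simplex_cocompact KB Kcob.
split; last by rewrite PeanoNat.Nat.sub_succ PeanoNat.Nat.sub_0_r; exact: lattice_subgroup lfin.
move=> a v Aa /gV[i v0 [c vi]]; have [s s0 Ta] := pos_group_exists A_L A_subgroup Aa.
have [t t0 tE] := w_eig _ i Ta; apply/pt_eqP; split=> //.
exists (s^-1 * t); first by rewrite mulf_neq0 ?invr_eq0 // gt_eqF.
rewrite tov_act vi -scalemxAr -[tom a](scalerK s0) -scalemxAl tE !scalerA.
by congr (_ *: _); ring.
Qed.

End Triple.

Theorem mainTheorem1 (d : nat) (Om C : vec -> Prop) (L A : mat -> Prop) :
  naive_cc_triple d Om C L ->
  maximal_abelian_subgroup d L A ->
  exists (S : vec -> Prop) (g : mat) (k : nat),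
    simplex_by d S g k /\
    (forall v, S v -> C v) /\
    properly_embedded d S C /\
    (forall a v, A a -> nz_vec d v -> (S (mat_act d a v) <-> S v)) /\
    acts_cocompactly d A S /\
    (forall a v, A a -> simplex_vertex d g k v -> pt_eq d (mat_act d a v) v) /\
    (exists B, finite_index d B A /\ iso_Zm d (k - 1)%coq_nat B).
Proof.
move=> [[pOm [[f [_ [fOm [M OmM]]]] oOm]]
  [sL [_ [dL [LAut [pC [exC [COm [clC [cvC [LC qC]]]]]]]]]]].
move=> [sA [AL [abA maxA]]].
(* In dimension [0] there is no nonzero vector, contradicting that [C] has a point. *)
case: d => [|n] in pOm fOm OmM oOm sL dL LAut pC clC cvC LC qC sA abA maxA *.
  have [v Cv] := exC; have [i [/ssrnat.ltP]] := proj1 pC v Cv.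
  by rewrite ltn0.
exact: (flat_torus_of_triple pOm fOm OmM oOm sL dL LAut pC exC COm clC cvC LC qC sA AL abA maxA).
Qed.
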